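(* For every real number $k>1$ there exists $\varepsilon\in(0,\tfrac12)$ with $k(1-2\varepsilon)^2>1$ (so that partial recovery in the broadcast tree model with these parameters is possible), and yet there is a monotone cutting adversary for which partial recovery in the cutting semirandom broadcast tree model is information-theoretically impossible: no estimator of the root spin, as a function of the observed tree and the spins of its leaves, achieves partial recovery.
   Context: Broadcast tree model with parameters $k>0$, $\varepsilon\in[0,\frac12)$ and depth $R$ (equivalently $a=2k(1-\varepsilon)$, $b=2k\varepsilon$): the root $\rho$ (level 0) gets a uniformly random spin $\sigma_\rho\in\{\pm1\}$; each node gives birth independently to $\mathrm{Pois}(a/2)$ children of its own spin and $\mathrm{Pois}(b/2)$ children of the opposite spin, until level $R$; nodes at level $R$ are the leaves. Cutting semirandom model: sample such a precursor tree; an adversary (seeing the whole labeled tree) may delete any edges joining a node to a child of opposite spin, thereby removing the corresponding subtrees; the resulting tree (topology) together with the spins of its remaining leaves is observed, the removed subtrees are not revealed. An estimator $\hat\sigma_\rho$ achieves partial recovery if there exists $\eta>\frac12$ such that $\Pr[\hat\sigma_\rho=\sigma_\rho]\ge\eta$ as $R\to\infty$. (It is known that partial recovery in the random broadcast tree model is possible when $k(1-2\varepsilon)^2>1$.) *)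

(* Defs.v *)
From HB Require Import structures.
From mathcomp Require Import all_boot all_order all_algebra.
From mathcomp Require Import all_classical all_reals all_analysis.

Set Implicit Arguments.
Unset Strict Implicit.
Unset Printing Implicit Defensive.
Import Order.TTheory GRing.Theory Num.Theory.
Local Open Scope classical_set_scope.
Local Open Scope ring_scope.

Inductive tree (L : Type) : Type := Node of L & seq (tree L).

Section TreeChoice.
Variable L : Type.

Fixpoint tree_encode (t : tree L) : GenTree.tree L :=
  let: Node x cs := t in
  GenTree.Node 0 (GenTree.Leaf x :: map tree_encode cs).

Fixpoint tree_decode (g : GenTree.tree L) : option (tree L) :=
  if g is GenTree.Node _ (GenTree.Leaf x :: gs)
  then Some (Node x (pmap tree_decode gs)) else None.

Fixpoint tree_encodeK (t : tree L) : tree_decode (tree_encode t) = Some t.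
Proof.
case: t => x cs /=; congr (Some (Node x _)).
by elim: cs => //= c cs IHcs; rewrite tree_encodeK /= IHcs.
Qed.

End TreeChoice.

HB.instance Definition _ (L : eqType) :=
  Equality.copy (tree L) (pcan_type (@tree_encodeK L)).
HB.instance Definition _ (L : choiceType) :=
  Choice.copy (tree L) (pcan_type (@tree_encodeK L)).

Definition root_label (L : Type) (t : tree L) : L := let: Node x _ := t in x.

(* Isomorphism of rooted labelled trees, children being unordered. *)
Inductive tree_iso (L : Type) : tree L -> tree L -> Prop :=
| TreeIso x cs cs' : forest_iso cs cs' -> tree_iso (Node x cs) (Node x cs')
with forest_iso (L : Type) : seq (tree L) -> seq (tree L) -> Prop :=
| ForestIsoNil : forest_iso [::] [::]
| ForestIsoCons c c' cs cs1 cs2 :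
    tree_iso c c' -> forest_iso cs (cs1 ++ cs2) ->
    forest_iso (c :: cs) (cs1 ++ c' :: cs2).

(* Spins are booleans: true is +1, false is -1. *)

Section BroadcastTree.
Variable R : realType.

(* Probability mass function of the depth-d broadcast tree given the root spin
   s.  A node's own-spin children are listed before its opposite-spin ones;
   estimators, being invariant under tree_iso, cannot exploit this order. *)
Fixpoint broadcast_pmf (a b : R) (d : nat) (s : bool) (t : tree bool) : R :=
  if d is d'.+1 then
    let: Node x cs := t in
    let own := [seq c <- cs | root_label c == s] in
    let opp := [seq c <- cs | root_label c == ~~ s] in
    if (x == s) && (cs == own ++ opp) then
      (poisson_pmf (a / 2) (size own) *
         \prod_(c <- own) broadcast_pmf a b d' s c) *
      (poisson_pmf (b / 2) (size opp) *
         \prod_(c <- opp) broadcast_pmf a b d' (~~ s) c)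
    else 0
  else (t == Node s [::])%:R.

Definition broadcast_prob (a b : R) (d : nat) (A : set (tree bool)) : \bar R :=
  \esum_(t in A) (2^-1 * broadcast_pmf a b d (root_label t) t)%:E.

End BroadcastTree.

(* cut_tree t t': t' is obtained from t by deleting some edges between a node
   and a child of opposite spin, with the subtrees hanging from them. *)
Inductive cut_tree : tree bool -> tree bool -> Prop :=
| CutTree s cs cs' : cut_children s cs cs' -> cut_tree (Node s cs) (Node s cs')
with cut_children : bool -> seq (tree bool) -> seq (tree bool) -> Prop :=
| CutNil s : cut_children s [::] [::]
| CutDelete s c cs cs' :
    root_label c = ~~ s -> cut_children s cs cs' ->
    cut_children s (c :: cs) cs'
| CutKeep s c c' cs cs' :
    cut_tree c c' -> cut_children s cs cs' ->
    cut_children s (c :: cs) (c' :: cs').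

(* The first argument of adversaries and estimators is the depth. *)
Definition cutting_adversary (adv : nat -> tree bool -> tree bool) : Prop :=
  forall d t, cut_tree t (adv d t).

(* Only the nodes at level d, the leaves, keep their spin. *)
Fixpoint observe (d : nat) (t : tree bool) : tree (option bool) :=
  let: Node s cs := t in
  if d is d'.+1 then Node None [seq observe d' c | c <- cs]
  else Node (Some s) [::].

Definition root_estimator (est : nat -> tree (option bool) -> bool) : Prop :=
  forall d o o', tree_iso o o' -> est d o = est d o'.

Definition partial_recovery (R : realType) (a b : R)
    (adv : nat -> tree bool -> tree bool)
    (est : nat -> tree (option bool) -> bool) : Prop :=
  exists2 eta : R, 2^-1 < eta &
    \forall d \near \oo,
      (eta%:E <= broadcast_prob a b d
        [set t | est d (observe d (adv d t)) = root_label t])%E.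

(* Main.v *)
Require Import Defs.
From mathcomp Require Import all_boot all_order all_algebra.
From mathcomp Require Import all_classical all_reals all_analysis.
From mathcomp Require Import ring lra.
Import Order.TTheory GRing.Theory Num.Theory.
Import numFieldNormedType.Exports.
Set Implicit Arguments.
Unset Strict Implicit.
Unset Printing Implicit Defensive.
Local Open Scope classical_set_scope.
Local Open Scope ring_scope.

(** On a path u - v - w whose middle vertex has no other child, deleting the
    configurations where v differs from both u and w weakens the correlation
    between u and w, since these are configurations with w = u.  Deleting all of
    them would overshoot and make the correlation negative for small
    1 - 2 eps, so the deletion is made conditional on an event independent of
    everything observed: the adversary erases every childless child of v of
    spin opposite to v, and cuts v off only if it erased at least one.

    The adversary works on blocks of two levels.  The observed children of a
    vertex form a Poisson process whose intensity depends on its spin, and the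
    squared Hellinger distance of two Poisson processes is at most that of
    their intensities.  Without cuts, a generation therefore multiplies the
    squared Hellinger distance between the laws given the two root spins by at
    most k (1 - 2 eps)^2, the mean offspring times the contraction along an
    edge.  The thinned paths are strictly more contracting than two edges, so
    that at k (1 - 2 eps)^2 = 1 a block has a factor below 1.  By continuity
    this persists for slightly smaller eps, and the two laws merge as the depth
    grows. *)

(** * Weighted sums *)

Section EsumComplements.
Context {R : realType}.
Local Open Scope ereal_scope.

Lemma EFin_addl_eq (x : \bar R) (p q : R) : p%:E + x = q%:E -> x = (q - p)%:E.
Proof. by case: x => [x| |] //= [<-]; rewrite addrAC subrr add0r. Qed.

Lemma ge0_mule_mixture (c e : R) (x y z : \bar R) :
  (0 <= c <= e)%R -> 0 <= x -> 0 <= y -> 0 <= z ->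
  c%:E * (x + z) + (e - c)%:E * (y + z) =
    e%:E * z + (c%:E * x + (e - c)%:E * y).
Proof.
move=> /andP[c0 ce] x0 y0 z0; have ec0 : (0 <= e - c)%R by rewrite subr_ge0.
rewrite !ge0_muleDr// addeACA addeC; congr (_ + _).
by rewrite -ge0_muleDl ?lee_fin// -EFinD addrC subrK.
Qed.

Lemma ge0_esumZl (T : choiceType) (D : set T) (c : \bar R) (f : T -> \bar R) :
  0 <= c -> (forall x, 0 <= f x) ->
  \esum_(x in D) (c * f x) = c * \esum_(x in D) f x.
Proof.
case: c => [c c0 f0|_ f0|//].
  rewrite /esum -ereal_supZl//; last first.
    by apply/set0P; exists 0, set0; [exact: fsets_set0|rewrite fsbig_set0].
  congr ereal_sup; apply/seteqP; split => [_ [X FX <-]|_ [_ [X FX <-] <-]] /=.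
    by exists (\sum_(x \in X) f x); [exists X|rewrite ge0_mule_fsumr].
  by exists X; rewrite ?ge0_mule_fsumr.
have [f_eq0|] := pselect (forall x, D x -> f x = 0).
  by rewrite !esum1 ?mule0// => x Dx; rewrite f_eq0 ?mule0.
move=> /existsNP[x /not_implyP[Dx /eqP fx_neq0]].
have fx_gt0 : 0 < f x by rewrite lt_def fx_neq0 f0.
have ge_term (h : T -> \bar R) :
    (forall y, 0 <= h y) -> h x <= \esum_(y in D) h y.
  move=> h0; rewrite (esumID [set x])// setI1 mem_set// esum_set1// leeDl//.
  exact: esum_ge0.
rewrite [RHS]gt0_mulye; last exact: lt_le_trans fx_gt0 (ge_term _ f0).
apply/eqP; rewrite -leye_eq (le_trans _ (ge_term _ _)) ?gt0_mulye// => y.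
by rewrite mule_ge0.
Qed.

Lemma esum_pair (S T : choiceType) (f : S -> T -> \bar R) :
  (forall x y, 0 <= f x y) ->
  \esum_(x in [set: S]) \esum_(y in [set: T]) f x y =
  \esum_(p in [set: S * T]) f p.1 p.2.
Proof.
by move=> f0; rewrite esum_esum//; congr esum; apply/seteqP; split.
Qed.

Lemma esum_swap (S T : choiceType) (f : S -> T -> \bar R) :
  (forall x y, 0 <= f x y) ->
  \esum_(x in [set: S]) \esum_(y in [set: T]) f x y =
  \esum_(y in [set: T]) \esum_(x in [set: S]) f x y.
Proof.
move=> f0; rewrite !esum_pair//.
rewrite (@reindex_esum _ _ _ [set: T * S] [set: S * T] (fun p => (p.2, p.1)))//.
split=> //; first by move=> [x y] [x' y'] _ _ /= [-> ->].
by move=> [x y] _; exists (y, x).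
Qed.

Lemma esum_restrict (T : choiceType) (A : set T) (f : T -> \bar R) :
  (forall x, ~ A x -> f x = 0) ->
  \esum_(x in [set: T]) f x = \esum_(x in A) f x.
Proof.
move=> fA; rewrite [RHS]esum_mkcond; apply: eq_esum => x _.
by case: ifPn => //; rewrite notin_setE => /fA.
Qed.

Lemma esum_single (T : choiceType) (t : T) (f : T -> \bar R) : 0 <= f t ->
  (forall x, x != t -> f x = 0) -> \esum_(x in [set: T]) f x = f t.
Proof.
move=> ft0 f_eq0; rewrite (@esum_restrict _ [set t]) ?esum_set1//.
by move=> x /eqP/f_eq0.
Qed.

Lemma esum_bool (f : bool -> \bar R) : (forall x, 0 <= f x) ->
  \esum_(x in [set: bool]) f x = f true + f false.
Proof.
move=> f0; rewrite (esumID [set true])// !setTI esum_set1//.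
rewrite (_ : ~` [set true] = [set false]) ?esum_set1//.
by apply/seteqP; split => -[] //= /(_ erefl).
Qed.

Lemma esum_seq (T : choiceType) (f : seq T -> \bar R) : (forall l, 0 <= f l) ->
  \esum_(l in [set: seq T]) f l =
  f [::] + \esum_(x in [set: T]) \esum_(l in [set: seq T]) f (x :: l).
Proof.
move=> f0; rewrite (esumID [set [::]])// !setTI esum_set1// esum_pair//.
congr (_ + _).
rewrite (@reindex_esum _ _ _ [set: T * seq T] _ (fun p => p.1 :: p.2))//.
split=> //; first by move=> [x l] [x' l'] _ _ /= [-> ->].
by move=> [|x l] //= _; exists (x, l).
Qed.

Lemma esum_tree (L : choiceType) (f : tree L -> \bar R) :
  (forall t, 0 <= f t) ->
  \esum_(t in [set: tree L]) f t =
  \esum_(x in [set: L]) \esum_(cs in [set: seq (tree L)]) f (Node x cs).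
Proof.
move=> f0; rewrite esum_pair//.
rewrite (@reindex_esum _ _ _ [set: L * seq (tree L)] _
  (fun p => Node p.1 p.2))//.
split=> //; first by move=> [x l] [x' l'] _ _ /= [-> ->].
by move=> [x l] _; exists (x, l).
Qed.

Lemma esum_antidiagonal (f : nat -> nat -> \bar R) : (forall i j, 0 <= f i j) ->
  \esum_(n in [set: nat]) \sum_(0 <= i < n.+1) f i (n - i)%N =
  \esum_(i in [set: nat]) \esum_(j in [set: nat]) f i j.
Proof.
move=> f0; transitivity
    (\esum_(n in [set: nat]) \esum_(i in `I_n.+1) f i (n - i)%N).
  by apply: eq_esum => n _; rewrite esum_fset// big_mkord -fsbig_ord.
rewrite esum_esum// [RHS]esum_pair//.
rewrite (@reindex_esum _ _ _ [set: nat * nat] _ (fun p => (p.1 + p.2, p.1)%N)).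
  by apply: eq_esum => -[i j] _ /=; rewrite addKn.
split.
- by move=> [i j] _; split => //=; rewrite ltnS leq_addr.
- by move=> [i j] [i' j'] _ _ /= [] + ii; rewrite ii => /addnI ->.
- by move=> [n i] [_ /= le_in]; exists (i, n - i)%N => //=; rewrite subnKC.
Qed.

Lemma esum_expR (x : R) : (0 <= x)%R ->
  \esum_(n in [set: nat]) (n`!%:R^-1 * x ^+ n)%:E = (expR x)%:E.
Proof.
move=> x0; rewrite -nneseries_esumT; last first.
  by move=> n; rewrite lee_fin mulr_ge0 ?exprn_ge0.
rewrite expRE -EFin_lim; last first.
  rewrite /pseries/=; under eq_fun do rewrite mulrC.
  exact: is_cvg_series_exp_coeff.
by apply/congr_lim/funext => n/=; rewrite /pseries/= /series/= -sumEFin.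
Qed.

End EsumComplements.

Definition wsum (R : realType) (T : choiceType) (w : T -> R) (F : T -> \bar R) :
    \bar R :=
  (\esum_(x in [set: T]) ((w x)%:E * F x))%E.

Notation mass w := (wsum w (fun=> 1%E)).

Section WeightedSum.
Context {R : realType}.
Local Open Scope ereal_scope.

Section Basics.
Variables (T : choiceType) (w : T -> R).
Hypothesis w0 : forall x, (0 <= w x)%R.
Implicit Types F G : T -> \bar R.

Lemma wsum_ge0 F : (forall x, 0 <= F x) -> 0 <= wsum w F.
Proof. by move=> F0; apply: esum_ge0 => x _; rewrite mule_ge0// lee_fin. Qed.

Lemma eq_wsum F G : (forall x, w x != 0%R -> F x = G x) -> wsum w F = wsum w G.
Proof.
move=> FG; apply: eq_esum => x _; have [->|/FG -> //] := eqVneq (w x) 0%R.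
by rewrite !mul0e.
Qed.

Lemma wsumD F G : (forall x, 0 <= F x) -> (forall x, 0 <= G x) ->
  wsum w (fun x => F x + G x) = wsum w F + wsum w G.
Proof.
move=> F0 G0; rewrite /wsum -esumD => [|x _|x _]; rewrite ?mule_ge0 ?lee_fin//.
by apply: eq_esum => x _; rewrite ge0_muleDr.
Qed.

Lemma wsumZl (c : \bar R) F : 0 <= c -> (forall x, 0 <= F x) ->
  wsum w (fun x => c * F x) = c * wsum w F.
Proof.
move=> c0 F0; rewrite /wsum -ge0_esumZl// => [|x]; last first.
  by rewrite mule_ge0 ?lee_fin.
by apply: eq_esum => x _; rewrite muleCA.
Qed.

Lemma wsum_cst (c : \bar R) : 0 <= c -> wsum w (fun=> c) = c * mass w.
Proof.
by move=> c0; rewrite -wsumZl//; apply: eq_wsum => x _; rewrite mule1.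
Qed.

Lemma wsumID (P : pred T) F : (forall x, 0 <= F x) ->
  wsum w F = wsum w (fun x => if P x then F x else 0) +
             wsum w (fun x => if P x then 0 else F x).
Proof.
move=> F0; rewrite -wsumD => [|x|x]; [|by case: ifP..].
by apply: eq_wsum => x _; case: ifP; rewrite ?adde0 ?add0e.
Qed.

Lemma wsum_esum (S : choiceType) (F : T -> S -> \bar R) :
  (forall x y, 0 <= F x y) ->
  wsum w (fun x => \esum_(y in [set: S]) F x y) =
  \esum_(y in [set: S]) wsum w (F ^~ y).
Proof.
move=> F0; rewrite /wsum -esum_swap => [|x y]; last first.
  by rewrite mule_ge0 ?lee_fin.
by apply: eq_esum => x _; rewrite ge0_esumZl ?lee_fin.
Qed.

Lemma wsum_sum (I : choiceType) (r : seq I) (F : I -> T -> \bar R) :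
  (forall i x, 0 <= F i x) ->
  wsum w (fun x => \sum_(i <- r) F i x) = \sum_(i <- r) wsum w (F i).
Proof.
move=> F0; rewrite /wsum -esum_sum => [|x i _ _]; last first.
  by rewrite mule_ge0 ?lee_fin.
by apply: eq_esum => x _; rewrite ge0_sume_distrr.
Qed.

Lemma wsum_pushforward (Y : choiceType) (g : T -> option Y) (m : R) :
  mass w = m%:E ->
  exists2 v : Y -> R, (forall y, (0 <= v y)%R) &
    forall f, (forall y, 0 <= f y) ->
      wsum v f = wsum w (fun x => if g x is Some y then f y else 0).
Proof.
move=> wm; pose W y := wsum w (fun x => (g x == Some y)%:R%:E).
have W_ge0 y : 0 <= W y by apply: wsum_ge0 => x; rewrite lee_fin.
have W_fin y : (fine (W y))%:E = W y.
  rewrite fineK// ge0_fin_numE// (@le_lt_trans _ _ m%:E) ?ltry// -wm.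
  by apply: le_esum => x _; rewrite lee_wpmul2l ?lee_fin// lern1 leq_b1.
exists (fine \o W) => [y|f f0]; first exact: fine_ge0.
rewrite /wsum; under eq_esum => y _ do rewrite /= W_fin muleC -wsumZl//.
rewrite -wsum_esum => [|x y]; last by rewrite mule_ge0// lee_fin.
apply: eq_wsum => x _; case: (g x) => [y|]; last first.
  by rewrite esum1// => y _; rewrite mule0.
rewrite (@esum_single _ _ y) ?eqxx ?mule1// => y' yy'.
by rewrite (_ : Some y == Some y' = false) ?mule0//;
  apply: contraNF yy' => /eqP[->].
Qed.

End Basics.

Lemma wsum_swap (S T : choiceType) (v : S -> R) (w : T -> R)
    (F : S -> T -> \bar R) :
  (forall x, (0 <= v x)%R) -> (forall y, (0 <= w y)%R) ->
  (forall x y, 0 <= F x y) ->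
  wsum v (fun x => wsum w (F x)) = wsum w (fun y => wsum v (F ^~ y)).
Proof.
move=> v0 w0 F0; rewrite {2}/wsum wsum_esum// => [|x y].
  by apply: eq_esum => y _; rewrite wsumZl ?lee_fin.
by rewrite mule_ge0 ?lee_fin.
Qed.

Section WeightOperations.
Variable T : choiceType.
Implicit Types (v w : T -> R) (F : T -> \bar R).

Lemma wsum_weightD v w F :
  (forall x, (0 <= v x)%R) -> (forall x, (0 <= w x)%R) ->
  (forall x, 0 <= F x) -> wsum (fun x => v x + w x)%R F = wsum v F + wsum w F.
Proof.
move=> v0 w0 F0; rewrite /wsum -esumD => [|x _|x _];
  rewrite ?mule_ge0 ?lee_fin//.
by apply: eq_esum => x _; rewrite EFinD ge0_muleDl// lee_fin.
Qed.

Lemma wsum_weightZ (c : R) w F : (0 <= c)%R -> (forall x, (0 <= w x)%R) ->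
  (forall x, 0 <= F x) -> wsum (fun x => c * w x)%R F = c%:E * wsum w F.
Proof.
move=> c0 w0 F0; rewrite /wsum -ge0_esumZl => [||x];
  rewrite ?mule_ge0 ?lee_fin//.
by apply: eq_esum => x _; rewrite EFinM muleA.
Qed.

Lemma le_wsum_weight v w F :
  (forall x, 0 <= F x) -> (forall x, (v x <= w x)%R) ->
  wsum v F <= wsum w F.
Proof.
by move=> F0 vw; apply: le_esum => x _; rewrite lee_wpmul2r// lee_fin.
Qed.

Lemma wsum_pred1 w t F : (0 <= w t)%R -> 0 <= F t ->
  wsum w (fun x => if x == t then F x else 0) = (w t)%:E * F t.
Proof.
move=> wt0 Ft0; rewrite /wsum (@esum_single _ _ t) ?eqxx ?mule_ge0 ?lee_fin//.
by move=> x /negbTE ->; rewrite mule0.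
Qed.

Lemma wsum_pred1_pair (S : choiceType) (v : S -> R) w a b (c : \bar R) :
  (0 <= v a)%R -> (0 <= w b)%R -> 0 <= c ->
  wsum v (fun x => wsum w (fun y => if (x == a) && (y == b) then c else 0)) =
  (v a * w b)%:E * c.
Proof.
move=> va0 wb0 c0; rewrite /wsum (@esum_single _ _ a) => [||x /negbTE xa].
- by rewrite eqxx/= -/(wsum w _) wsum_pred1// EFinM muleA.
- by rewrite eqxx/= -/(wsum w _) wsum_pred1// !mule_ge0 ?lee_fin.
- by rewrite xa esum1 ?mule0// => y _; rewrite mule0.
Qed.

Lemma wsum_single w t F : (0 <= w t)%R -> 0 <= F t ->
  (forall x, x != t -> w x = 0%R) -> wsum w F = (w t)%:E * F t.
Proof.
move=> wt0 Ft0 w_eq0; rewrite /wsum (@esum_single _ _ t)// ?mule_ge0 ?lee_fin//.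
by move=> x /w_eq0 ->; rewrite mul0e.
Qed.

Lemma wsum_singletons (w : seq T -> R) (F : seq T -> \bar R) :
  (forall l, (0 <= w l)%R) -> (forall l, 0 <= F l) ->
  wsum w (fun l => if size l == 1%N then F l else 0) =
  wsum (fun x => w [:: x]) (fun x => F [:: x]).
Proof.
move=> w0 F0; rewrite {1}/wsum esum_seq => [|l]; last first.
  by rewrite mule_ge0 ?lee_fin//; case: ifP.
rewrite mule0 add0e; apply: eq_esum => x _; rewrite (@esum_single _ _ [::])//.
  by rewrite mule_ge0 ?lee_fin.
by case=> // y l _; rewrite mule0.
Qed.

Lemma wsum_cat (u v w : seq T -> R) (F : seq T -> \bar R) :
  (forall l, (0 <= v l)%R) -> (forall l, (0 <= w l)%R) ->
  (forall l, 0 <= F l) ->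
  (forall l, (u l)%:E =
    wsum v (fun l1 => wsum w (fun l2 => (l1 ++ l2 == l)%:R%:E))) ->
  wsum u F = wsum v (fun l1 => wsum w (fun l2 => F (l1 ++ l2))).
Proof.
move=> v0 w0 F0 uE.
have F_at l : F l = \esum_(l' in [set: seq T]) (F l' * (l == l')%:R%:E).
  rewrite (@esum_single _ _ l) ?eqxx ?mule1// => l' /negbTE.
  by rewrite eq_sym => ->; rewrite mule0.
under [RHS]eq_wsum => l1 _.
  under eq_wsum => l2 _ do rewrite F_at.
  rewrite wsum_esum// => [|l2 l]; last by rewrite mule_ge0.
  under eq_esum => l _ do rewrite wsumZl//.
  over.
rewrite wsum_esum// => [|l1 l]; last by rewrite mule_ge0// wsum_ge0.
apply: eq_esum => l _; rewrite uE muleC -wsumZl// => l1.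
exact: wsum_ge0.
Qed.

Lemma wsum_Node (w : tree T -> R) x (F : tree T -> \bar R) :
  (forall t, (0 <= w t)%R) -> (forall t, 0 <= F t) ->
  (forall t, w t != 0%R -> root_label t == x) ->
  wsum w F = wsum (w \o Node x) (F \o Node x).
Proof.
move=> w0 F0 w_root.
have wF0 t : 0 <= (w t)%:E * F t by rewrite mule_ge0 ?lee_fin.
rewrite {1}/wsum esum_tree// (@esum_single _ _ x)//; first exact: esum_ge0.
move=> y yx; apply: esum1 => cs _.
by rewrite (contraNeq (w_root (Node y cs)) yx) mul0e.
Qed.

Lemma wsum_bool_pair (w : bool * T -> R) (F : bool * T -> \bar R) :
  (forall x, (0 <= w x)%R) -> (forall x, 0 <= F x) ->
  wsum w F = wsum (fun o => w (true, o)) (fun o => F (true, o)) +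
             wsum (fun o => w (false, o)) (fun o => F (false, o)).
Proof.
move=> w0 F0.
rewrite -(@esum_bool _ (fun c => wsum _ (fun o => F (c, o)))) => [|c].
  rewrite esum_pair => [|c o]; last by rewrite mule_ge0// lee_fin.
  by apply: eq_esum => -[].
exact: wsum_ge0.
Qed.

End WeightOperations.
End WeightedSum.

(** * Poisson point processes *)

Definition perm_invariant (T : eqType) (U : Type) (G : seq T -> U) : Prop :=
  forall l l', perm_eq l l' -> G l = G l'.

Definition rel_invariant (T U : Type) (e : T -> T -> Prop)
    (f : T -> U) : Prop :=
  forall y y', e y y' -> f y = f y'.

Definition entrywise_invariant (T U : Type) (e : T -> T -> Prop)
    (G : seq T -> U) : Prop :=
  forall l1 l2, rel_invariant e (fun y => G (l1 ++ y :: l2)).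

Section PoissonWeight.
Context {R : realType}.
Local Open Scope ereal_scope.

Section Definitions.
Variables (T : choiceType) (w : T -> R).

Definition prod_weight (n : nat) (l : seq T) : R :=
  if size l == n then (\prod_(x <- l) w x)%R else 0%R.

(* Up to the factor [expR (- mass w)], the law of the Poisson point process of
   intensity [w], its points being listed in random order. *)
Definition poisson_weight (l : seq T) : R :=
  ((size l)`!%:R^-1 * \prod_(x <- l) w x)%R.

End Definitions.

Section Slices.
Variables (T : choiceType) (w : T -> R).
Hypothesis w0 : forall x, (0 <= w x)%R.
Implicit Type F : seq T -> \bar R.

Lemma prod_weight_ge0 n l : (0 <= prod_weight w n l)%R.
Proof. by rewrite /prod_weight; case: ifP => // _; exact: prodr_ge0. Qed.

Lemma poisson_weight_ge0 l : (0 <= poisson_weight w l)%R.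
Proof. by rewrite mulr_ge0 ?invr_ge0// prodr_ge0. Qed.

Lemma poisson_weight_nil : poisson_weight w [::] = 1%R.
Proof. by rewrite /poisson_weight big_nil mulr1 fact0 invr1. Qed.

Lemma poisson_weight_single x : poisson_weight w [:: x] = w x.
Proof. by rewrite /poisson_weight big_seq1 (_ : 1`! = 1%N)// invr1 mul1r. Qed.

Lemma poisson_weight_neq0 l : poisson_weight w l != 0%R ->
  all (fun x => w x != 0%R) l.
Proof.
rewrite /poisson_weight mulf_eq0 negb_or prodf_seq_neq0 => /andP[_].
by apply: sub_all => x.
Qed.

Lemma poisson_weightZ (c : R) l :
  poisson_weight (fun x => c * w x)%R l = (c ^+ size l * poisson_weight w l)%R.
Proof.
rewrite /poisson_weight big_split/= big_const_seq count_predT iter_mulr_1.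
by rewrite mulrCA.
Qed.

Lemma wsum_prod_weight0 F : (forall l, 0 <= F l) ->
  wsum (prod_weight w 0) F = F [::].
Proof.
move=> F0; rewrite (@wsum_single _ _ _ [::]) ?prod_weight_ge0//.
  by rewrite /prod_weight big_nil mul1e.
by case.
Qed.

Lemma wsum_prod_weightS n F : (forall l, 0 <= F l) ->
  wsum (prod_weight w n.+1) F =
  wsum w (fun x => wsum (prod_weight w n) (fun l => F (x :: l))).
Proof.
have prod0 := prod_weight_ge0.
move=> F0; rewrite {1}/wsum esum_seq => [|l]; last by rewrite mule_ge0 ?lee_fin.
rewrite mul0e add0e; apply: eq_esum => x _; rewrite -wsumZl ?lee_fin//.
apply: eq_esum => l _; rewrite /prod_weight /= eqSS big_cons.
by case: ifP; rewrite ?mul0e// EFinM muleCA muleA.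
Qed.

Lemma wsum_poisson_weight F : (forall l, 0 <= F l) ->
  wsum (poisson_weight w) F =
  \esum_(n in [set: nat]) ((n`!%:R^-1)%:E * wsum (prod_weight w n) F).
Proof.
move=> F0; have prod0 := prod_weight_ge0.
have Fl0 n l : 0 <= (n`!%:R^-1)%:E * F l by rewrite mule_ge0 ?lee_fin ?invr_ge0.
under [RHS]eq_esum => n _ do rewrite -wsumZl ?lee_fin ?invr_ge0//.
rewrite esum_swap => [|n l]; last by rewrite mule_ge0 ?lee_fin.
apply: eq_esum => l _; rewrite (@esum_single _ _ (size l)).
- by rewrite /prod_weight eqxx EFinM muleAC muleA muleC muleA.
- by rewrite mule_ge0 ?lee_fin.
- by move=> n nl; rewrite /prod_weight eq_sym (negbTE nl) mul0e.
Qed.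

Lemma wsum_poisson_split_nil F : (forall l, 0 <= F l) ->
  wsum (poisson_weight w) F =
  F [::] + wsum (poisson_weight w) (fun l => if nilp l then 0 else F l).
Proof.
move=> F0; rewrite (wsumID poisson_weight_ge0 (pred1 [::]))//.
rewrite wsum_pred1//; last exact: poisson_weight_ge0.
by rewrite poisson_weight_nil mul1e; congr (_ + _); apply: eq_wsum => -[].
Qed.

Lemma wsum_poisson_split_single F : (forall l, 0 <= F l) ->
  wsum (poisson_weight w) F =
  wsum w (fun x => F [:: x]) +
  wsum (poisson_weight w) (fun l => if size l == 1%N then 0 else F l).
Proof.
move=> F0; rewrite (wsumID poisson_weight_ge0 (fun l => size l == 1%N))//.
rewrite wsum_singletons//; last exact: poisson_weight_ge0.
by congr (_ + _); apply: eq_esum => x _; rewrite poisson_weight_single.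
Qed.

Lemma mass_prod_weight n m : mass w = m%:E ->
  mass (prod_weight w n) = (m ^+ n)%:E.
Proof.
move=> wm; elim: n => [|n IHn]; first by rewrite wsum_prod_weight0.
rewrite wsum_prod_weightS//; under eq_wsum => x _ do rewrite IHn.
rewrite wsum_cst// ?wm -?EFinM -?exprSr// lee_fin exprn_ge0// -lee_fin -wm.
exact: wsum_ge0.
Qed.

Lemma mass_poisson_weight m : mass w = m%:E ->
  mass (poisson_weight w) = (expR m)%:E.
Proof.
move=> wm; have m0 : (0 <= m)%R by rewrite -lee_fin -wm wsum_ge0.
rewrite wsum_poisson_weight// -esum_expR//.
by apply: eq_esum => n _; rewrite (mass_prod_weight _ wm) -EFinM.
Qed.

Lemma wsum_poisson_nilp m (phi : bool -> \bar R) :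
  (forall c, 0 <= phi c) -> mass w = m%:E ->
  wsum (poisson_weight w) (fun l => phi (nilp l)) =
  phi true + (expR m - 1)%:E * phi false.
Proof.
move=> phi0 wm; rewrite wsum_poisson_split_nil//=; congr (_ + _).
have -> : (expR m - 1)%:E =
    wsum (poisson_weight w) (fun l => if nilp l then 0 else 1).
  have := mass_poisson_weight wm; rewrite wsum_poisson_split_nil//.
  by move=> /EFin_addl_eq <-.
rewrite muleC -wsumZl => [|l|//|l]; rewrite ?poisson_weight_ge0//;
  last by case: ifP.
by apply: eq_wsum => l _; case: nilp; rewrite ?mule0 ?mule1.
Qed.

End Slices.
End PoissonWeight.

Section Superposition.
Context {R : realType}.
Variable T : choiceType.
Local Open Scope ereal_scope.

Lemma pascal_sum n (K : nat -> nat -> \bar R) : (forall i j, 0 <= K i j) ->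
  \sum_(0 <= i < n.+1) ('C(n, i)%:R%:E * (K i.+1 (n - i)%N + K i (n - i).+1)) =
  \sum_(0 <= i < n.+2) ('C(n.+1, i)%:R%:E * K i (n.+1 - i)%N).
Proof.
move=> K0; rewrite [RHS]big_nat_recl//= bin0 mul1e subn0.
under eq_bigr do rewrite ge0_muleDr//.
under [in RHS]eq_bigr => i _ do
  rewrite binS natrD EFinD ge0_muleDl ?lee_fin// subSS.
rewrite !big_split/= addeA addeC; congr (_ + _).
rewrite [in RHS]big_nat_recr//= bin_small// mul0e adde0.
rewrite [in LHS]big_nat_recl//= bin0 mul1e subn0; congr (_ + _).
by apply: eq_big_nat => i /andP[_ lt_in]; rewrite subnSK.
Qed.

Variables v w : T -> R.
Hypothesis v0 : forall x, (0 <= v x)%R.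
Hypothesis w0 : forall x, (0 <= w x)%R.
Implicit Type G : seq T -> \bar R.

Let concat_sum G i j : \bar R :=
  wsum (prod_weight v i)
    (fun l1 => wsum (prod_weight w j) (fun l2 => G (l1 ++ l2))).

Let inner_sum_ge0 G j l1 : (forall l, 0 <= G l) ->
  0 <= wsum (prod_weight w j) (fun l2 => G (l1 ++ l2)).
Proof. by move=> G0; apply: wsum_ge0 => //; exact: prod_weight_ge0. Qed.

Let concat_sum_ge0 G i j : (forall l, 0 <= G l) -> 0 <= concat_sum G i j.
Proof.
move=> G0; apply: wsum_ge0 => [|l1]; first exact: prod_weight_ge0.
exact: inner_sum_ge0.
Qed.

Lemma wsum_prod_weightD n G : (forall l, 0 <= G l) -> perm_invariant G ->
  wsum (prod_weight (fun x => v x + w x)%R n) G =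
  \sum_(0 <= i < n.+1) ('C(n, i)%:R%:E * concat_sum G i (n - i)).
Proof.
have vw0 x : (0 <= v x + w x)%R by rewrite addr_ge0.
have v_ge0 := prod_weight_ge0 v0; have w_ge0 := prod_weight_ge0 w0.
elim: n G => [|n IHn] G G0 Gperm.
  rewrite big_nat1 bin0 mul1e /concat_sum !wsum_prod_weight0// => l1.
  exact: inner_sum_ge0.
rewrite wsum_prod_weightS//; under eq_wsum => x _.
  rewrite IHn// => [|l l' ll']; last first.
    by rewrite (Gperm _ (x :: l'))// perm_cons.
  over.
have cons_sum_ge0 x i j : 0 <= concat_sum (fun l => G (x :: l)) i j.
  exact: concat_sum_ge0.
rewrite wsum_sum// => [|i x]; last first.
  by apply: mule_ge0; [rewrite lee_fin|exact: cons_sum_ge0].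
rewrite -(pascal_sum n (fun i j => concat_sum_ge0 i j G0)).
apply: eq_bigr => i _; rewrite wsumZl ?lee_fin// wsum_weightD//.
congr (_ * (_ + _)).
  by rewrite /concat_sum wsum_prod_weightS// => l1; exact: wsum_ge0.
rewrite wsum_swap// => [|x l1]; last exact: wsum_ge0.
apply: eq_wsum => l1 _; rewrite wsum_prod_weightS//.
apply: eq_wsum => x _; apply: eq_wsum => l2 _; apply: Gperm.
by rewrite -cat_cons perm_sym -[x :: l2]cat1s perm_catCA.
Qed.

Lemma wsum_poisson_weightD G : (forall l, 0 <= G l) -> perm_invariant G ->
  wsum (poisson_weight (fun x => v x + w x)%R) G =
  wsum (poisson_weight v) (fun l1 =>
    wsum (poisson_weight w) (fun l2 => G (l1 ++ l2))).
Proof.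
move=> G0 Gperm; have v_ge0 := prod_weight_ge0 v0.
have inner0 j l1 := inner_sum_ge0 j l1 G0.
have sum0 i j := concat_sum_ge0 i j G0.
rewrite [LHS]wsum_poisson_weight// => [|x]; last by rewrite addr_ge0.
rewrite [RHS]wsum_poisson_weight// => [|l1]; last first.
  by apply: wsum_ge0 => // l2; exact: poisson_weight_ge0.
pose term i j := (i`!%:R^-1)%:E * ((j`!%:R^-1)%:E * concat_sum G i j).
transitivity (\esum_(n in [set: nat]) \sum_(0 <= i < n.+1) term i (n - i)%N).
  apply: eq_esum => n _; rewrite wsum_prod_weightD// ge0_sume_distrr => [|i _].
    rewrite big_nat [RHS]big_nat; apply: eq_bigr => i /andP[_ le_in].
    rewrite /term !muleA -!EFinM; congr (_%:E * _).
    rewrite -(bin_fact (ltnSE le_in)) !natrM; field.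
    by rewrite !pnatr_eq0 -!lt0n !fact_gt0 bin_gt0 -ltnS.
  by rewrite mule_ge0 ?lee_fin.
rewrite esum_antidiagonal => [|i j]; last by rewrite !mule_ge0.
apply: eq_esum => i _.
under [in RHS]eq_wsum => l1 _ do rewrite wsum_poisson_weight//.
rewrite wsum_esum// => [|l1 j]; last by rewrite mule_ge0.
rewrite -ge0_esumZl// => [|j]; last first.
  by apply: wsum_ge0 => // l1; rewrite mule_ge0.
by apply: eq_esum => j _; congr (_ * _); rewrite wsumZl.
Qed.

End Superposition.

Section Thinning.
Context {R : realType}.
Variables (X Y : choiceType) (w' : Y -> R) (g : X -> option Y).
Variable e : Y -> Y -> Prop.
Hypothesis w'0 : forall y, (0 <= w' y)%R.
Local Open Scope ereal_scope.

Definition image_weight (w : X -> R) : Prop := forall f : Y -> \bar R,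
  (forall y, 0 <= f y) -> rel_invariant e f ->
  wsum w (fun x => if g x is Some y then f y else 0) = wsum w' f.

Section Mapping.
Variable v : X -> R.
Hypothesis v0 : forall x, (0 <= v x)%R.
Hypothesis v_kept : forall x, v x != 0%R -> g x.
Hypothesis w'_image : image_weight v.

Lemma wsum_prod_weight_pmap n (H : seq Y -> \bar R) :
  (forall l, 0 <= H l) -> entrywise_invariant e H ->
  wsum (prod_weight v n) (fun l => H (pmap g l)) = wsum (prod_weight w' n) H.
Proof.
have prod0 := prod_weight_ge0 w'0.
elim: n H => [|n IHn] H H0 Hinv; first by rewrite !wsum_prod_weight0.
rewrite !wsum_prod_weightS// -w'_image => [|y|y y' yy'].
- apply: eq_wsum => x /v_kept /=; case: (g x) => //= y _.
  by rewrite (IHn (fun l => H (y :: l)))// => l1 l2; exact: (Hinv (y :: l1)).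
- exact: wsum_ge0.
- by apply: eq_wsum => l _; exact: (Hinv [::]).
Qed.

Lemma wsum_poisson_pmap (H : seq Y -> \bar R) :
  (forall l, 0 <= H l) -> entrywise_invariant e H ->
  wsum (poisson_weight v) (fun l => H (pmap g l)) = wsum (poisson_weight w') H.
Proof.
move=> H0 Hinv; rewrite !wsum_poisson_weight//.
by apply: eq_esum => n _; rewrite wsum_prod_weight_pmap.
Qed.

End Mapping.

Lemma wsum_poisson_thinning (w : X -> R) (G : seq X -> seq Y -> \bar R) :
  (forall x, (0 <= w x)%R) -> image_weight w -> (forall k l, 0 <= G k l) ->
  (forall k, perm_invariant (G k)) -> (forall l, perm_invariant (G ^~ l)) ->
  (forall k, entrywise_invariant e (G k)) ->
  wsum (poisson_weight w) (fun l => G [seq x <- l | ~~ g x] (pmap g l)) =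
  wsum (poisson_weight (fun x => if g x then 0 else w x)%R)
    (fun k => wsum (poisson_weight w') (G k)).
Proof.
move=> w0 w'_image G0 Gperm Gperm' Ginv.
pose kept x := (if g x then w x else 0)%R.
pose erased x := (if g x then 0 else w x)%R.
have kept0 x : (0 <= kept x)%R by rewrite /kept; case: ifP.
have erased0 x : (0 <= erased x)%R by rewrite /erased; case: ifP.
have -> : poisson_weight w = poisson_weight (fun x => kept x + erased x)%R.
  congr poisson_weight; apply/funext => x; rewrite /kept /erased.
  by case: ifP; rewrite ?addr0 ?add0r.
have kept_image x : kept x != 0%R -> g x.
  by rewrite /kept; case: ifP => //; rewrite eqxx.
have erased_image x : erased x != 0%R -> ~~ g x.
  by rewrite /erased; case: ifP => //; rewrite eqxx.
have image_kept : image_weight kept.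
  move=> f f0 finv; rewrite -w'_image//; apply: eq_esum => x _.
  by rewrite /kept; case: (g x); rewrite ?mule0.
rewrite wsum_poisson_weightD// => [|l l' ll']; last first.
  rewrite (Gperm' _ _ _ (perm_filter _ ll')).
  exact/Gperm/perm_pmap.
transitivity (wsum (poisson_weight kept) (fun l1 =>
    wsum (poisson_weight erased) (fun l2 => G l2 (pmap g l1)))).
  apply: eq_wsum => l1 /poisson_weight_neq0 /(@sub_all _ _ g kept_image) g_l1.
  apply: eq_wsum => l2 /poisson_weight_neq0 /(sub_all erased_image) g_l2.
  rewrite filter_cat pmap_cat (all_filterP g_l2).
  rewrite (_ : [seq x <- l1 | ~~ g x] = [::]); last first.
    by apply/eqP; rewrite -[_ == _]negbK -has_filter has_predC negbK.
  rewrite (_ : pmap g l2 = [::]) ?cats0//; apply/size0nil; rewrite size_pmap.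
  by apply/eqP; rewrite -leqn0 leqNgt -has_count -all_predC.
rewrite wsum_swap//; [|exact: poisson_weight_ge0..].
by apply: eq_wsum => l2 _; apply: wsum_poisson_pmap.
Qed.

End Thinning.

Lemma wsum_poisson_map (R : realType) (X Y : choiceType) (w : X -> R)
    (w' : Y -> R) (h : X -> Y) (H : seq Y -> \bar R) :
  (forall x, 0 <= w x) -> (forall y, 0 <= w' y) -> (forall l, 0 <= H l)%E ->
  (forall f, (forall y, 0 <= f y)%E -> wsum w (f \o h) = wsum w' f) ->
  wsum (poisson_weight w) (H \o map h) = wsum (poisson_weight w') H.
Proof.
move=> w0 w'0 H0 w'_image.
rewrite -(@wsum_poisson_pmap _ _ _ _ (Some \o h) eq w'0 w)//.
- by move=> f f0 _; exact: w'_image.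
- by move=> l1 l2 y y' ->.
Qed.

(** * The offspring process of the broadcast tree *)

Definition children (L : Type) (t : tree L) : seq (tree L) :=
  let: Node _ cs := t in cs.

Section Offspring.
Context {R : realType}.

Lemma broadcast_pmf_ge0 (a b : R) d s t : 0 <= broadcast_pmf a b d s t.
Proof.
elim: d s t => [|d IHd] s t /=; first exact: ler0n.
case: t => x cs; case: ifP => // _.
by rewrite !mulr_ge0 ?poisson_pmf_ge0// prodr_ge0.
Qed.

Lemma broadcast_pmf_neq0 (a b : R) d s t :
  broadcast_pmf a b d s t != 0 -> root_label t == s.
Proof.
case: d t => [|d] [x cs] /=; last by case: (x =P s) => // _; rewrite eqxx.
by rewrite pnatr_eq0 eqb0 negbK => /eqP[->].
Qed.

Lemma filter_root_label_cat (s : bool) (l1 l2 : seq (tree bool)) :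
  all (fun c => root_label c == s) l1 ->
  all (fun c => root_label c == ~~ s) l2 ->
  [seq c <- l1 ++ l2 | root_label c == s] = l1 /\
  [seq c <- l1 ++ l2 | root_label c == ~~ s] = l2.
Proof.
move=> own1 opp2; rewrite !filter_cat (all_filterP own1) (all_filterP opp2).
have neg x : (x == s) = ~~ (x == ~~ s) by case: x (s) => -[].
have nil (P : pred (tree bool)) l :
    all (predC P) l -> [seq c <- l | P c] = [::].
  by rewrite all_predC has_filter negbK => /eqP.
rewrite !nil ?cats0//; first by apply: sub_all own1 => c /=; rewrite neg.
by apply: sub_all opp2 => c /=; rewrite neg negbK.
Qed.

Variables p q : R.
Hypotheses (p0 : 0 < p) (q0 : 0 < q).
Local Notation pmf := (broadcast_pmf (2 * p) (2 * q)).

Definition childless_prob : R := expR (- (p + q)).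

Definition offspring_weight d s (c : tree bool) : R :=
  p * pmf d s c + q * pmf d (~~ s) c.

Lemma childless_prob_ge0 : 0 <= childless_prob.
Proof. exact: expR_ge0. Qed.

Lemma scaled_pmf_ge0 (c : R) : 0 < c -> forall d s t, 0 <= c * pmf d s t.
Proof. by move=> c0 d s t; rewrite mulr_ge0 ?broadcast_pmf_ge0// ltW. Qed.

Lemma offspring_weight_ge0 d s c : 0 <= offspring_weight d s c.
Proof. by rewrite addr_ge0 ?scaled_pmf_ge0. Qed.

Lemma broadcast_pmfS d s cs :
  let own := [seq c <- cs | root_label c == s] in
  let opp := [seq c <- cs | root_label c == ~~ s] in
  pmf d.+1 s (Node s cs) = if own ++ opp == cs then
    childless_prob * (poisson_weight (fun c => p * pmf d s c) own *
                      poisson_weight (fun c => q * pmf d (~~ s) c) opp) else 0.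
Proof.
rewrite /= eqxx [_ == cs]eq_sym/=; case: ifP => // _.
rewrite !(mulrC 2) !mulfK ?pnatr_eq0// !poisson_weightZ /poisson_pmf p0 q0.
rewrite /childless_prob /poisson_weight opprD expRD; ring.
Qed.

Local Open Scope ereal_scope.

Lemma broadcast_pmf_cat d s cs :
  (pmf d.+1 s (Node s cs))%:E = childless_prob%:E *
  wsum (poisson_weight (fun c => p * pmf d s c)%R) (fun l1 =>
    wsum (poisson_weight (fun c => q * pmf d (~~ s) c)%R) (fun l2 =>
      (l1 ++ l2 == cs)%:R%:E)).
Proof.
set own := [seq c <- cs | root_label c == s].
set opp := [seq c <- cs | root_label c == ~~ s].
set P := poisson_weight _; set Q := poisson_weight _.
have P0 := poisson_weight_ge0 (scaled_pmf_ge0 p0 d s).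
have Q0 := poisson_weight_ge0 (scaled_pmf_ge0 q0 d (~~ s)).
have all_root c s' l : poisson_weight (fun t => c * pmf d s' t)%R l != 0%R ->
    all (fun t => root_label t == s') l.
  move=> /poisson_weight_neq0; apply: sub_all => t /=.
  by rewrite mulf_eq0 negb_or => /andP[_ /broadcast_pmf_neq0].
have -> : wsum P (fun l1 => wsum Q (fun l2 => (l1 ++ l2 == cs)%:R%:E)) =
    wsum P (fun l1 => wsum Q (fun l2 =>
      if (l1 == own) && (l2 == opp) then (own ++ opp == cs)%:R%:E else 0)).
  apply: eq_wsum => l1 /all_root l1_own; apply: eq_wsum => l2 /all_root l2_opp.
  have [own_cat opp_cat] := filter_root_label_cat l1_own l2_opp.
  case: (l1 ++ l2 =P cs) => [cs_cat|/eqP/negbTE cat_neq].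
    by rewrite /own /opp -cs_cat own_cat opp_cat !eqxx.
  by case: ifP => // /andP[/eqP <- /eqP <-]; rewrite cat_neq.
rewrite wsum_pred1_pair// broadcast_pmfS -/own -/opp.
by case: ifP; rewrite ?mule0 ?mule1// -EFinM.
Qed.

Lemma wsum_broadcast d s (F : tree bool -> \bar R) : (forall t, 0 <= F t) ->
  wsum (pmf d.+1 s) F = childless_prob%:E *
  wsum (poisson_weight (fun c => p * pmf d s c)%R) (fun l1 =>
    wsum (poisson_weight (fun c => q * pmf d (~~ s) c)%R) (fun l2 =>
      F (Node s (l1 ++ l2)))).
Proof.
move=> F0; set P := poisson_weight _; set Q := poisson_weight _.
have P0 := poisson_weight_ge0 (scaled_pmf_ge0 p0 d s).
have Q0 := poisson_weight_ge0 (scaled_pmf_ge0 q0 d (~~ s)).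
rewrite (@wsum_Node _ _ _ s)//; last 2 first.
- exact: broadcast_pmf_ge0.
- exact: broadcast_pmf_neq0.
rewrite -(wsum_weightZ childless_prob_ge0 P0) => [|l1]; last exact: wsum_ge0.
apply: wsum_cat => // [l|l|cs].
- by rewrite mulr_ge0 ?childless_prob_ge0.
- exact: F0.
rewrite broadcast_pmf_cat wsum_weightZ ?childless_prob_ge0// => l1.
by apply: wsum_ge0 => // l2; rewrite lee_fin.
Qed.

Lemma wsum_broadcast_sym d s (F : tree bool -> \bar R) : (forall t, 0 <= F t) ->
  perm_invariant (F \o Node s) ->
  wsum (pmf d.+1 s) F =
  childless_prob%:E *
    wsum (poisson_weight (offspring_weight d s)) (F \o Node s).
Proof.
move=> F0 Fperm; rewrite wsum_broadcast// wsum_poisson_weightD//.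
- exact: scaled_pmf_ge0 p0 _ _.
- exact: scaled_pmf_ge0 q0 _ _.
- by move=> l; exact: F0.
Qed.

Lemma wsum_offspring d s (F : tree bool -> \bar R) : (forall t, 0 <= F t) ->
  wsum (offspring_weight d s) F =
  p%:E * wsum (pmf d s) F + q%:E * wsum (pmf d (~~ s)) F.
Proof.
move=> F0; rewrite wsum_weightD//.
- by rewrite !wsum_weightZ// ?ltW// => t; exact: broadcast_pmf_ge0.
- exact: scaled_pmf_ge0 p0 _ _.
- exact: scaled_pmf_ge0 q0 _ _.
Qed.

Lemma mass_broadcast d s : mass (pmf d s) = 1.
Proof.
elim: d s => [|d IHd] s.
  rewrite (@wsum_single _ _ _ (Node s [::])) /= ?eqxx ?mule1// => t /negbTE.
  by move=> ->.
rewrite wsum_broadcast_sym//.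
rewrite (@mass_poisson_weight _ _ _ _ (p + q)%R) => [||]; last 2 first.
- exact: offspring_weight_ge0.
- by rewrite wsum_offspring// !IHd !mule1.
by rewrite -EFinM -expRD addNr expR0.
Qed.

Lemma mass_offspring d s : mass (offspring_weight d s) = (p + q)%:E.
Proof. by rewrite wsum_offspring// !mass_broadcast !mule1. Qed.

Section ThinnedOffspring.
Variables (d : nat) (s : bool) (Y : choiceType) (w' : Y -> R).
Variables (g : tree bool -> option Y) (e : Y -> Y -> Prop) (m : R).
Hypothesis w'0 : forall y, (0 <= w' y)%R.
Hypothesis w'_mass : mass w' = m%:E.
Hypothesis w'_image : image_weight w' g e (offspring_weight d s).

Lemma mass_erased_offspring :
  mass (fun c => if g c then 0 else offspring_weight d s c)%R = (p + q - m)%:E.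
Proof.
apply: EFin_addl_eq; rewrite -w'_mass -(mass_offspring d s) -w'_image//.
have w0 c := offspring_weight_ge0 d s c.
rewrite [RHS](wsumID w0 (fun c => g c))//; congr (_ + _).
  by apply: eq_wsum => c _; case: (g c).
by apply: eq_esum => c _; case: ifP; rewrite ?mule0 ?mul0e.
Qed.

Lemma image_offspring_mass_le : (m <= p + q)%R.
Proof.
rewrite -subr_ge0 -lee_fin -mass_erased_offspring; apply: wsum_ge0 => // c.
by case: ifP; rewrite // offspring_weight_ge0.
Qed.

Lemma wsum_thinned_offspring (G : bool -> seq Y -> \bar R) :
  (forall c l, 0 <= G c l) -> (forall c, perm_invariant (G c)) ->
  (forall c, entrywise_invariant e (G c)) ->
  wsum (pmf d.+1 s) (fun t =>
    G (has (fun c => ~~ g c) (children t)) (pmap g (children t))) =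
  childless_prob%:E * wsum (poisson_weight w') (G false) +
  (expR (- m) - childless_prob)%:E * wsum (poisson_weight w') (G true).
Proof.
move=> G0 Gperm Ginv; have w0 := offspring_weight_ge0 d s.
have sum0 c : 0 <= wsum (poisson_weight w') (G c).
  by apply: wsum_ge0 => //; exact: poisson_weight_ge0.
rewrite wsum_broadcast_sym// => [|l l' ll'/=]; last first.
  by rewrite (perm_has _ ll') (Gperm _ _ _ (perm_pmap g ll')).
pose H (k : seq (tree bool)) := G (~~ nilp k).
rewrite (@eq_wsum _ _ _ _
    (fun l => H [seq c <- l | ~~ g c] (pmap g l))) => [|l _]; last first.
  by rewrite /H /= has_filter /nilp size_eq0.
rewrite (wsum_poisson_thinning w'0 w0 w'_image); last 4 first.
- by move=> k l; exact: G0.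
- by move=> k; exact: Gperm.
- by move=> l k k' kk'; rewrite /H /nilp (perm_size kk').
- by move=> k; exact: Ginv.
have erased0 c : (0 <= if g c then 0 else offspring_weight d s c)%R.
  by case: ifP.
rewrite (wsum_poisson_nilp erased0 (phi := fun c => wsum _ (G (~~ c))) _
  mass_erased_offspring)//=.
rewrite ge0_muleDr ?mule_ge0 ?lee_fin ?subr_ge0 -?expR0 ?ler_expR//; last first.
  by rewrite subr_ge0 image_offspring_mass_le.
rewrite muleA -EFinM mulrBr expR0 mulr1 -expRD; congr (_ + (expR _ - _)%:E * _).
by ring.
Qed.

End ThinnedOffspring.
End Offspring.

(** * The cutting adversary *)

Section TreeIso.
Variable L : choiceType.

Fixpoint tree_iso_refl (t : tree L) : tree_iso t t.
Proof.
case: t => x cs; constructor; elim: cs => [|c cs IHcs]; first by constructor.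
exact: (@ForestIsoCons _ c c cs [::] cs).
Qed.

Lemma forest_iso_refl (cs : seq (tree L)) : forest_iso cs cs.
Proof.
elim: cs => [|c cs IHcs]; first by constructor.
exact: (@ForestIsoCons _ c c cs [::] cs (tree_iso_refl c)).
Qed.

Lemma perm_forest_iso (l l' : seq (tree L)) : perm_eq l l' -> forest_iso l l'.
Proof.
elim: l l' => [|c l IHl] l' ll'.
  by move: ll'; rewrite perm_sym => /perm_nilP ->; constructor.
have cl' : c \in l' by rewrite -(perm_mem ll') mem_head.
case/splitPr: cl' ll' => l1 l2 ll'; constructor; first exact: tree_iso_refl.
apply: IHl; rewrite -(perm_cons c) (permPl ll') perm_catC/= perm_cons.
by rewrite perm_catC.
Qed.

Lemma forest_iso_entry (l1 l2 : seq (tree L)) c c' : tree_iso c c' ->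
  forest_iso (l1 ++ c :: l2) (l1 ++ c' :: l2).
Proof.
move=> cc'; elim: l1 => [|y l1 IHl1] /=.
  exact: (@ForestIsoCons _ _ _ _ [::] _ cc' (forest_iso_refl _)).
exact: (@ForestIsoCons _ _ _ _ [::] _ (tree_iso_refl y) IHl1).
Qed.

Section Invariance.
Variables (U : Type) (F : tree L -> U) (x : L).
Hypothesis Finv : rel_invariant (@tree_iso L) F.

Lemma perm_invariant_Node : perm_invariant (F \o Node x).
Proof.
by move=> l l' ll'; apply: Finv; constructor; exact: perm_forest_iso.
Qed.

Lemma entrywise_invariant_Node :
  entrywise_invariant (@tree_iso L) (F \o Node x).
Proof.
by move=> l1 l2 c c' cc'; apply: Finv; constructor; exact: forest_iso_entry.
Qed.

End Invariance.
End TreeIso.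

Definition childless (L : Type) (t : tree L) : bool := nilp (children t).

Definition dead_opposite (s : bool) (t : tree bool) : bool :=
  (root_label t == ~~ s) && childless t.

(* The presence of a deleted [dead_opposite] child is a random bit that stays
   hidden from the estimator: it makes the deletion of the path from the parent
   through [v] to its grandchild rare enough not to reverse their
   correlation. *)
Definition cut_edge (s : bool) (v : tree bool) : bool :=
  let: Node x ws := v in
  [&& x == ~~ s, has (dead_opposite x) ws &
      [seq root_label w == x | w <- ws & ~~ dead_opposite x w] == [:: false]].

Definition prune_grandchild (f : tree bool -> tree bool) x (w : tree bool) :=
  if dead_opposite x w then None else Some (f w).

Definition prune_child (f : tree bool -> tree bool) s (v : tree bool) :=
  let: Node x ws := v in
  if cut_edge s v then None else Some (Node x (pmap (prune_grandchild f x) ws)).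

Fixpoint adversary (d : nat) (t : tree bool) : tree bool :=
  match d with
  | (d'.+1 as e).+2 =>
    let: Node s cs := t in Node s (pmap (prune_child (adversary e) s) cs)
  | _ => t
  end.

Fixpoint cut_tree_refl (t : tree bool) : cut_tree t t.
Proof.
by case: t => x cs; constructor; elim: cs => [|c cs IHcs]; constructor.
Qed.

Lemma cut_children_pmap s (g : tree bool -> option (tree bool)) cs :
  (forall c, if g c is Some c' then cut_tree c c' else root_label c = ~~ s) ->
  cut_children s cs (pmap g cs).
Proof.
move=> gP; elim: cs => /= [|c cs IHcs]; first by constructor.
by have := gP c; case: (g c) => [c'|] /= gc; constructor.
Qed.

Lemma adversary_cutting : cutting_adversary adversary.
Proof.
move=> d t; have [n] := ubnP d; elim: n d t => // n IHn [|[|[|d]]] t lt_dn;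
  try exact: cut_tree_refl.
case: t => s cs; constructor; apply: cut_children_pmap => -[x ws] /=.
case: ifPn => [/and3P[/eqP-> //]|_].
constructor; apply: cut_children_pmap => w; rewrite /prune_grandchild.
case: ifPn => [/andP[/eqP-> //]|_]; apply: (IHn d.+1 w).
by rewrite (leq_trans _ (ltnSE lt_dn)).
Qed.

Lemma adversary_childless d (t : tree bool) : childless t -> adversary d t = t.
Proof. by case: d t => [|[|[|d]]] [s [|c cs]]. Qed.

Definition observation d (t : tree bool) : tree (option bool) :=
  observe d (adversary d t).

Definition observed_child d s (v : tree bool) : option (tree (option bool)) :=
  omap (observe d.+2) (prune_child (adversary d.+1) s v).

Lemma map_pmap (S T U : Type) (f : T -> U) (g : S -> option T) l :
  map f (pmap g l) = pmap (omap f \o g) l.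
Proof. by elim: l => //= x l <-; case: (g x). Qed.

Lemma observation_Node d s cs :
  observation d.+3 (Node s cs) = Node None (pmap (observed_child d s) cs).
Proof. by rewrite /observation /= map_pmap. Qed.

Definition mark d x (w : tree bool) : option (bool * tree (option bool)) :=
  if dead_opposite x w then None else Some (root_label w == x, observation d w).

Definition cut_marks s x dead (l : seq (bool * tree (option bool))) : bool :=
  [&& x == ~~ s, dead & [seq y.1 | y <- l] == [:: false]].

Lemma observed_childE d s x ws : observed_child d s (Node x ws) =
  if cut_marks s x (has (fun w => ~~ mark d.+1 x w) ws) (pmap (mark d.+1 x) ws)
  then None else Some (Node None [seq y.2 | y <- pmap (mark d.+1 x) ws]).
Proof.
rewrite /observed_child /prune_child /cut_edge /cut_marks.
have -> : has (dead_opposite x) ws = has (fun w => ~~ mark d.+1 x w) ws.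
  by apply: eq_has => w; rewrite /mark; case: ifP.
have -> : [seq root_label w == x | w <- ws & ~~ dead_opposite x w] =
    [seq y.1 | y <- pmap (mark d.+1 x) ws].
  elim: ws => //= w ws IHws; rewrite [mark _ _ w]/mark.
  by case: dead_opposite; rewrite /= IHws.
case: ifP => //= _; congr (Some (Node _ _)); rewrite !map_pmap.
by apply: eq_pmap => w; rewrite /prune_grandchild /mark /=; case: ifP.
Qed.

Definition mark_iso (y y' : bool * tree (option bool)) : Prop :=
  y.1 = y'.1 /\ tree_iso y.2 y'.2.

Lemma cut_marks_perm s x dead : perm_invariant (cut_marks s x dead).
Proof.
move=> l l' ll'; rewrite /cut_marks; congr [&& _, _ & _].
have spins := perm_map fst ll'.
apply/eqP/eqP => spinsE; rewrite spinsE ?[perm_eq [:: _] _]perm_sym in spins.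
all: exact: perm_small_eq spins.
Qed.

Lemma cut_marks_iso s x dead :
  entrywise_invariant mark_iso (cut_marks s x dead).
Proof. by move=> l1 l2 y y' [y1 _]; rewrite /cut_marks !map_cat /= y1. Qed.

(** * Law of the observation of a two-level block *)

Section Block.
Context {R : realType}.
Variables p q : R.
Hypotheses (p0 : 0 < p) (q0 : 0 < q).
Local Notation T := (tree (option bool)).
Local Notation empty := (Node None [::] : T).
Local Notation pmf := (broadcast_pmf (2 * p) (2 * q)).
Local Notation childless_prob := (childless_prob p q).
Implicit Types (L : bool -> T -> R) (s x : bool).

(* [L s] is the law of the observation on the event that the root, of spin [s],
   has a child in the precursor tree, up to isomorphism of observations. *)
Definition live_law d L : Prop := forall s (F : bool -> T -> \bar R),
  (forall c o, 0 <= F c o)%E ->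
  (forall c, rel_invariant (@tree_iso _) (F c)) ->
  (wsum (pmf d s) (fun t => F (~~ childless t) (observation d t)) =
   wsum (L s) (F true) + childless_prob%:E * F false empty)%E.

Definition dead_rate : R := q * childless_prob.
Definition no_dead_prob : R := expR (- dead_rate).
Definition live_mass : R := 1 - childless_prob.
Definition grandchild_mass : R := p + q * live_mass.

Definition own_weight L x (o : T) : R :=
  p * (L x o + childless_prob * (o == empty)%:R).
Definition opp_weight L x (o : T) : R := q * L (~~ x) o.
Definition grandchild_weight L x (o : T) : R :=
  own_weight L x o + opp_weight L x o.
Definition mark_weight L x (y : bool * T) : R :=
  if y.1 then own_weight L x y.2 else opp_weight L x y.2.

(* The children of a vertex of spin [x] that is not cut off; [kap] is the
   probability that it survives when its only observed child has the opposite
   spin. *)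
Definition kept_weight (kap : R) L x (l : seq T) : R :=
  expR (- grandchild_mass) *
  (if l is [:: o] then own_weight L x o + kap * opp_weight L x o
   else poisson_weight (grandchild_weight L x) l).

Definition forest_weight L s (l : seq T) : R :=
  p * kept_weight 1 L s l + q * kept_weight no_dead_prob L (~~ s) l.

Definition node_weight (phi : seq T -> R) (o : T) : R :=
  if o is Node None l then phi l else 0.

Definition child_weight L s : T -> R := node_weight (forest_weight L s).

Definition kept_mass (kap : R) : R := expR (- grandchild_mass) *
  (kap * (q * live_mass) + (p + (expR grandchild_mass - grandchild_mass))).

Definition child_mass : R := p * kept_mass 1 + q * kept_mass no_dead_prob.

Definition next_law L s : T -> R := node_weight (fun l =>
  if nilp l then expR (- child_mass) - childless_prob
  else expR (- child_mass) * poisson_weight (child_weight L s) l).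

Lemma dead_rate_ge0 : 0 <= dead_rate.
Proof. by rewrite mulr_ge0 ?childless_prob_ge0// ltW. Qed.

Lemma no_dead_prob_ge0 : 0 <= no_dead_prob.
Proof. exact: expR_ge0. Qed.

Lemma live_mass_ge0 : 0 <= live_mass.
Proof. by rewrite subr_ge0 -expR0 ler_expR oppr_le0 addr_ge0// ltW. Qed.

Lemma grandchild_mass_ge0 : 0 <= grandchild_mass.
Proof. by rewrite addr_ge0 ?mulr_ge0 ?live_mass_ge0// ltW. Qed.

Lemma no_dead_probE :
  expR (- grandchild_mass) * no_dead_prob = childless_prob.
Proof.
rewrite -expRD /childless_prob /grandchild_mass /live_mass /dead_rate.
by congr expR; ring.
Qed.

Lemma childless_prob_le : 0 <= childless_prob <= expR (- grandchild_mass).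
Proof.
rewrite childless_prob_ge0 -no_dead_probE ler_piMr ?expR_ge0//.
by rewrite -expR0 ler_expR oppr_le0 dead_rate_ge0.
Qed.

Local Open Scope ereal_scope.

Lemma wsum_node_weight (phi : seq T -> R) (f : T -> \bar R) :
  (forall l, (0 <= phi l)%R) -> (forall o, 0 <= f o) ->
  wsum (node_weight phi) f = wsum phi (f \o Node None).
Proof.
move=> phi0 f0; rewrite (@wsum_Node _ _ _ None)//.
- by move=> [[y|] l] /=.
- by move=> [[y|] l] //=; rewrite eqxx.
Qed.

Section Weights.
Variable L : bool -> T -> R.
Hypothesis L0 : forall s o, (0 <= L s o)%R.

Lemma own_weight_ge0 x o : (0 <= own_weight L x o)%R.
Proof.
by rewrite mulr_ge0 ?(ltW p0)// addr_ge0// mulr_ge0 ?childless_prob_ge0.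
Qed.

Lemma opp_weight_ge0 x o : (0 <= opp_weight L x o)%R.
Proof. by rewrite mulr_ge0 ?(ltW q0). Qed.

Lemma grandchild_weight_ge0 x o : (0 <= grandchild_weight L x o)%R.
Proof. by rewrite addr_ge0 ?own_weight_ge0 ?opp_weight_ge0. Qed.

Lemma mark_weight_ge0 x y : (0 <= mark_weight L x y)%R.
Proof. by case: y => -[] o; rewrite ?own_weight_ge0 ?opp_weight_ge0. Qed.

Lemma kept_weight_ge0 (kap : R) x l : (0 <= kap)%R ->
  (0 <= kept_weight kap L x l)%R.
Proof.
move=> kap0; rewrite mulr_ge0 ?expR_ge0//.
have P0 := poisson_weight_ge0 (grandchild_weight_ge0 x).
by case: l => [|o [|o' l]] //;
  rewrite addr_ge0 ?own_weight_ge0// mulr_ge0 ?opp_weight_ge0.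
Qed.

Lemma forest_weight_ge0 s l : (0 <= forest_weight L s l)%R.
Proof.
have c0 := no_dead_prob_ge0.
by rewrite addr_ge0// mulr_ge0 ?kept_weight_ge0 ?(ltW p0) ?(ltW q0).
Qed.

Lemma child_weight_ge0 s o : (0 <= child_weight L s o)%R.
Proof. by case: o => [[y|] l] //=; exact: forest_weight_ge0. Qed.

Lemma wsum_own_weight x (f : T -> \bar R) : (forall o, 0 <= f o) ->
  wsum (own_weight L x) f = p%:E * (wsum (L x) f + childless_prob%:E * f empty).
Proof.
move=> f0.
have e0 (o : T) : (0 <= childless_prob * (o == empty)%:R)%R.
  by rewrite mulr_ge0 ?childless_prob_ge0.
rewrite wsum_weightZ ?(ltW p0)// => [|o]; last by rewrite addr_ge0.
congr (_ * _); rewrite wsum_weightD//; congr (_ + _).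
rewrite (@wsum_single _ _ _ empty) ?eqxx ?mulr1// ?childless_prob_ge0//.
by move=> o /negbTE ->; rewrite mulr0.
Qed.

Lemma wsum_opp_weight x (f : T -> \bar R) : (forall o, 0 <= f o) ->
  wsum (opp_weight L x) f = q%:E * wsum (L (~~ x)) f.
Proof. by move=> f0; rewrite wsum_weightZ// ltW. Qed.

Lemma wsum_grandchild_weight x (f : T -> \bar R) : (forall o, 0 <= f o) ->
  wsum (grandchild_weight L x) f =
  wsum (own_weight L x) f + wsum (opp_weight L x) f.
Proof.
by move=> f0; rewrite wsum_weightD//;
  [exact: own_weight_ge0|exact: opp_weight_ge0].
Qed.

Lemma wsum_mark_weight x (f : bool * T -> \bar R) : (forall y, 0 <= f y) ->
  wsum (mark_weight L x) f = wsum (own_weight L x) (fun o => f (true, o)) +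
                             wsum (opp_weight L x) (fun o => f (false, o)).
Proof. by move=> f0; rewrite wsum_bool_pair//; exact: mark_weight_ge0. Qed.

Lemma wsum_kept_weight (kap : R) x (phi : seq T -> \bar R) : (0 <= kap)%R ->
  (forall l, 0 <= phi l) ->
  wsum (kept_weight kap L x) phi = (expR (- grandchild_mass))%:E *
    (kap%:E * wsum (opp_weight L x) (fun o => phi [:: o]) +
     (wsum (own_weight L x) (fun o => phi [:: o]) +
      wsum (poisson_weight (grandchild_weight L x))
        (fun l => if size l == 1%N then 0 else phi l))).
Proof.
move=> kap0 phi0; have own0 := own_weight_ge0 x; have opp0 := opp_weight_ge0 x.
have kap_opp0 o : (0 <= kap * opp_weight L x o)%R by rewrite mulr_ge0.
have path0 o : (0 <= own_weight L x o + kap * opp_weight L x o)%R.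
  by rewrite addr_ge0.
have forest0 l : (0 <= if l is [:: o]
    then own_weight L x o + kap * opp_weight L x o
    else poisson_weight (grandchild_weight L x) l)%R.
  have poisson0 := poisson_weight_ge0 (grandchild_weight_ge0 x).
  by case: l => [|o []] //=.
rewrite wsum_weightZ ?expR_ge0//; congr (_ * _).
rewrite (wsumID forest0 (fun l => size l == 1%N))// wsum_singletons// addeA.
congr (_ + _); first by rewrite wsum_weightD// wsum_weightZ// addeC.
by apply: eq_esum => -[|o [|o' l]] _ //=; rewrite !mule0.
Qed.

Lemma wsum_forest_weight s (phi : seq T -> \bar R) : (forall l, 0 <= phi l) ->
  wsum (forest_weight L s) phi = p%:E * wsum (kept_weight 1 L s) phi +
    q%:E * wsum (kept_weight no_dead_prob L (~~ s)) phi.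
Proof.
move=> phi0.
have own0 l : (0 <= kept_weight 1 L s l)%R by exact: kept_weight_ge0.
have opp0 l : (0 <= kept_weight no_dead_prob L (~~ s) l)%R.
  by rewrite kept_weight_ge0 ?no_dead_prob_ge0.
rewrite wsum_weightD// => [|l|l].
- by rewrite (wsum_weightZ (ltW p0) own0)// (wsum_weightZ (ltW q0) opp0).
- by rewrite (mulr_ge0 (ltW p0)).
- by rewrite (mulr_ge0 (ltW q0)).
Qed.

Lemma wsum_child_weight s (f : T -> \bar R) : (forall o, 0 <= f o) ->
  wsum (child_weight L s) f = wsum (forest_weight L s) (f \o Node None).
Proof. by move=> f0; rewrite wsum_node_weight//; exact: forest_weight_ge0. Qed.

Section Masses.
Hypothesis L_mass : forall s, mass (L s) = live_mass%:E.

Lemma own_weight_mass x : mass (own_weight L x) = p%:E.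
Proof. by rewrite wsum_own_weight// L_mass mule1 -EFinD subrK mule1. Qed.

Lemma opp_weight_mass x : mass (opp_weight L x) = (q * live_mass)%:E.
Proof. by rewrite wsum_opp_weight// L_mass EFinM. Qed.

Lemma grandchild_weight_mass x :
  mass (grandchild_weight L x) = grandchild_mass%:E.
Proof.
by rewrite wsum_grandchild_weight// own_weight_mass opp_weight_mass.
Qed.

Lemma mark_weight_mass x : mass (mark_weight L x) = grandchild_mass%:E.
Proof.
by rewrite wsum_mark_weight// own_weight_mass opp_weight_mass.
Qed.

Lemma kept_weight_mass (kap : R) x : (0 <= kap)%R ->
  mass (kept_weight kap L x) = (kept_mass kap)%:E.
Proof.
move=> kap0; rewrite wsum_kept_weight// own_weight_mass opp_weight_mass.
have grandchild0 := grandchild_weight_ge0 x.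
have := mass_poisson_weight grandchild0 (grandchild_weight_mass x).
rewrite wsum_poisson_split_single// grandchild_weight_mass.
by move=> /EFin_addl_eq ->.
Qed.

Lemma child_weight_mass s : mass (child_weight L s) = child_mass%:E.
Proof.
rewrite wsum_child_weight// wsum_forest_weight//.
by rewrite !kept_weight_mass// ?no_dead_prob_ge0.
Qed.

End Masses.
End Weights.

Section Step.
Variables (d : nat) (L : bool -> T -> R).
Hypothesis L0 : forall s o, (0 <= L s o)%R.
Hypothesis L_law : live_law d.+1 L.

Lemma live_law_mass s : mass (L s) = live_mass%:E.
Proof.
have := mass_broadcast p0 q0 d.+1 s; rewrite (L_law s (F := fun _ _ => 1))//.
by rewrite mule1 addeC => /EFin_addl_eq.
Qed.

Lemma mark_image x : image_weight (mark_weight L x) (mark d.+1 x) mark_iso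
  (offspring_weight p q d.+1 x).
Proof.
move=> f f0 finv; rewrite wsum_offspring// => [|w]; last by case: (mark _ _ w).
rewrite wsum_mark_weight// wsum_own_weight// wsum_opp_weight//.
have neq : (x == ~~ x) = false by case: x.
congr (_ * _ + _ * _).
  rewrite -(L_law x (F := fun _ o => f (true, o))) => [|//|c o o' oo'].
    apply: eq_wsum => w /broadcast_pmf_neq0/eqP wx.
    by rewrite /mark /dead_opposite wx neq eqxx.
  exact: finv.
pose F (c : bool) o := if c then f (false, o) else 0.
transitivity (wsum (pmf d.+1 (~~ x))
    (fun w => F (~~ childless w) (observation d.+1 w))).
  apply: eq_wsum => w /broadcast_pmf_neq0/eqP wx.
  by rewrite /mark /dead_opposite wx eqxx eq_sym neq /F/=; case: childless.
rewrite L_law; first by rewrite mule0 adde0.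
- by rewrite /F; case.
- by case=> // o o' oo'; exact: finv.
Qed.

Lemma wsum_poisson_marks x cut (phi : seq T -> \bar R) :
  (forall l, 0 <= phi l) ->
  wsum (poisson_weight (mark_weight L x)) (fun l =>
    if cut && ([seq y.1 | y <- l] == [:: false]) then 0
    else phi [seq y.2 | y <- l]) =
  (if cut then 0 else wsum (opp_weight L x) (fun o => phi [:: o])) +
  (wsum (own_weight L x) (fun o => phi [:: o]) +
   wsum (poisson_weight (grandchild_weight L x))
     (fun l => if size l == 1%N then 0 else phi l)).
Proof.
move=> phi0; have mark0 := mark_weight_ge0 L0 x.
have grandchild0 := grandchild_weight_ge0 L0 x.
rewrite wsum_poisson_split_single// => [|l]; last by case: ifP.
rewrite addeA; congr (_ + _); last first.
  pose phi_ne1 l := if size l == 1%N then 0 else phi l.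
  have phi_ne1_ge0 l : 0 <= phi_ne1 l by rewrite /phi_ne1; case: ifP.
  rewrite -(@wsum_poisson_map _ _ _ (mark_weight L x)
    (grandchild_weight L x) snd)//.
    apply: eq_wsum => l _; rewrite /= /phi_ne1 size_map; case: ifP => // l_ne1.
    case: ifP => // /andP[_ /eqP l_marks].
    by move: l_ne1; rewrite -(size_map fst) l_marks.
  move=> f f0; rewrite (wsum_mark_weight L0) => [|y]; last exact: f0.
  by rewrite wsum_grandchild_weight.
rewrite (wsum_mark_weight L0)/= => [|y]; last by case: ifP.
rewrite andbF andbT addeC; congr (_ + _); case: ifP => // _.
by rewrite wsum_cst ?mul0e//; exact: opp_weight_ge0.
Qed.

Section ObservedChild.
Variables (s x : bool) (f : T -> \bar R).
Hypothesis f0 : forall o, 0 <= f o.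
Hypothesis f_inv : rel_invariant (@tree_iso _) f.

Let marks_value dead (l : seq (bool * T)) : \bar R :=
  if cut_marks s x dead l then 0 else f (Node None [seq y.2 | y <- l]).

Lemma wsum_observed_child_marks :
  wsum (pmf d.+2 x)
    (fun v => if observed_child d s v is Some o then f o else 0) =
  childless_prob%:E *
    wsum (poisson_weight (mark_weight L x)) (marks_value false) +
  (expR (- grandchild_mass) - childless_prob)%:E *
    wsum (poisson_weight (mark_weight L x)) (marks_value true).
Proof.
rewrite -(wsum_thinned_offspring p0 q0 (mark_weight_ge0 L0 x)
  (mark_weight_mass L0 live_law_mass x) (mark_image x)).
- apply: eq_wsum => v /broadcast_pmf_neq0; case: v => y ws /eqP /= ->.
  by rewrite observed_childE /marks_value; case: ifP.
- by move=> dead l; rewrite /marks_value; case: ifP.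
- move=> dead l l' ll'; rewrite /marks_value (cut_marks_perm _ _ _ ll').
  by case: ifP => // _;
    exact: (perm_invariant_Node None f_inv (perm_map snd ll')).
- move=> dead l1 l2 y y' yy'.
  rewrite /marks_value (cut_marks_iso _ _ _ _ _ yy') !map_cat.
  case: ifP => // _.
  exact: (entrywise_invariant_Node None f_inv _ _ (proj2 yy')).
Qed.

Lemma wsum_observed_child :
  wsum (pmf d.+2 x)
    (fun v => if observed_child d s v is Some o then f o else 0) =
  wsum (kept_weight (if x == s then 1 else no_dead_prob)%R L x)
    (f \o Node None).
Proof.
set kap := (if _ then _ else _)%R.
have kap0 : (0 <= kap)%R.
  by rewrite /kap; case: ifP => // _; exact: no_dead_prob_ge0.
have phi0 l : 0 <= (f \o Node None) l by exact: f0.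
rewrite (wsum_kept_weight L0 x kap0)//.
set B := wsum (opp_weight L x) _; set A := wsum (own_weight L x) _.
set N := wsum (poisson_weight (grandchild_weight L x)) _.
have B0 : 0 <= B by apply: wsum_ge0 => // o; exact: opp_weight_ge0.
have A0 : 0 <= A by apply: wsum_ge0 => // o; exact: own_weight_ge0.
have N0 : 0 <= N.
  apply: wsum_ge0 => [l|l]; last by case: ifP.
  exact/poisson_weight_ge0/grandchild_weight_ge0.
have marksE dead : wsum (poisson_weight (mark_weight L x)) (marks_value dead) =
    (if (x == ~~ s) && dead then 0 else B) + (A + N).
  rewrite -(wsum_poisson_marks _ _ phi0).
  by apply: eq_wsum => l _; rewrite /marks_value /cut_marks andbA.
have /andP[cp0 cp_le] := childless_prob_le.
rewrite wsum_observed_child_marks !marksE andbF andbT.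
rewrite ge0_mule_mixture//; last 3 first.
- exact/andP.
- by case: ifP.
- by rewrite adde_ge0.
rewrite [RHS]ge0_muleDr ?mule_ge0 ?adde_ge0 ?lee_fin// addeC; congr (_ + _).
rewrite muleA -EFinM /kap; have [->|xs] := eqVneq x s.
  rewrite (_ : (s == ~~ s) = false); last by case: (s).
  by rewrite -ge0_muleDl ?lee_fin ?subr_ge0// -EFinD addrC subrK mulr1.
rewrite (_ : x == ~~ s); last by case: (x) (s) xs => -[].
by rewrite mule0 adde0 no_dead_probE.
Qed.

End ObservedChild.

Lemma child_image s :
  image_weight (child_weight L s) (observed_child d s) (@tree_iso _)
    (offspring_weight p q d.+2 s).
Proof.
move=> f f0 f_inv.
rewrite wsum_offspring// => [|v]; last by case: observed_child.
rewrite !wsum_observed_child// eqxx.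
rewrite (_ : (~~ s == s) = false); last by case: (s).
by rewrite wsum_child_weight// wsum_forest_weight// => l; exact: f0.
Qed.

Lemma child_mass_le : (child_mass <= p + q)%R.
Proof.
exact: image_offspring_mass_le (child_weight_mass L0 live_law_mass true)
  (child_image true).
Qed.

Lemma next_law_ge0 s o : (0 <= next_law L s o)%R.
Proof.
case: o => [[y|] l] //=; case: ifP => _.
  by rewrite subr_ge0 ler_expR lerN2 child_mass_le.
rewrite mulr_ge0 ?expR_ge0// poisson_weight_ge0// => o; exact: child_weight_ge0.
Qed.

Lemma wsum_next_law s (f : T -> \bar R) : (forall o, 0 <= f o) ->
  wsum (next_law L s) f = (expR (- child_mass) - childless_prob)%:E * f empty +
    (expR (- child_mass))%:E * wsum (poisson_weight (child_weight L s))
      (fun l => if nilp l then 0 else f (Node None l)).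
Proof.
move=> f0; have C0 := child_weight_ge0 L0 s.
have next0 l : (0 <= if nilp l then expR (- child_mass) - childless_prob
    else expR (- child_mass) * poisson_weight (child_weight L s) l)%R.
  exact: (next_law_ge0 s (Node None l)).
have fN0 l : 0 <= (f \o Node None) l by exact: f0.
rewrite wsum_node_weight// (wsumID next0 (@nilp T))//.
congr (_ + _).
  rewrite /wsum (@esum_single _ _ [::])//=.
    by rewrite mule_ge0 ?lee_fin ?(next0 [::]).
  by move=> [|c l] //= _; rewrite mule0.
rewrite -wsumZl ?lee_fin ?expR_ge0//; last 2 first.
- exact: poisson_weight_ge0.
- by move=> l; case: ifP.
apply: eq_esum => l _; case: ifP => _; first by rewrite !mule0.
by rewrite EFinM muleCA muleA.
Qed.

Lemma live_law_next : live_law d.+3 (next_law L).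
Proof.
move=> s F F0 F_inv; have C0 := child_weight_ge0 L0 s.
pose G dead l := F (dead || ~~ nilp l) (Node None l).
set P := wsum (poisson_weight (child_weight L s))
  (fun l => if nilp l then 0 else F true (Node None l)).
have P0 : 0 <= P.
  by apply: wsum_ge0 => [l|l]; [exact: poisson_weight_ge0|case: ifP].
have sum_G dead : wsum (poisson_weight (child_weight L s)) (G dead) =
    F dead empty + P.
  rewrite wsum_poisson_split_nil// => [|l]; last exact: F0.
  rewrite /G orbF; congr (_ + _); apply: eq_wsum => l _.
  by case: ifP => //= ->; rewrite orbT.
transitivity (wsum (pmf d.+3 s) (fun t =>
    G (has (fun c => ~~ observed_child d s c) (children t))
      (pmap (observed_child d s) (children t)))).
  apply: eq_wsum => -[y cs] /broadcast_pmf_neq0/eqP /= ->.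
  rewrite observation_Node /G /childless; congr F.
  by case: cs => //= c cs; case: observed_child => //= o; rewrite orbT.
have cp0 := childless_prob_ge0 p q.
rewrite (wsum_thinned_offspring p0 q0 C0 (child_weight_mass L0 live_law_mass s)
  (child_image s)); last 3 first.
- by move=> dead l; exact: F0.
- move=> dead l l' ll'; rewrite /G /nilp (perm_size ll').
  exact: (perm_invariant_Node None (F_inv _) ll').
- move=> dead l1 l2 y y' yy'; rewrite /G /nilp !size_cat.
  exact: (entrywise_invariant_Node None (F_inv _) _ _ yy').
rewrite !sum_G ge0_mule_mixture//; last first.
  by rewrite cp0 ler_expR lerN2 child_mass_le.
by rewrite wsum_next_law// addeCA [RHS]addeC; congr (_ + _); exact: addeC.
Qed.

End Step.
End Block.

(** * The Hellinger distance *)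

Section SqrtDistance.
Context {R : realType}.
Implicit Types x y A B c delta : R.

Definition hellinger2 x y : R := (Num.sqrt x - Num.sqrt y) ^+ 2.

Definition mix_factor A B : R := (A - B) ^+ 2 / (A + B).

Lemma hellinger2_ge0 x y : 0 <= hellinger2 x y. Proof. exact: sqr_ge0. Qed.

Lemma hellinger2xx x : hellinger2 x x = 0.
Proof. by rewrite /hellinger2 subrr expr0n. Qed.

Lemma hellinger2M c x y : 0 <= c ->
  hellinger2 (c * x) (c * y) = c * hellinger2 x y.
Proof.
by move=> c0; rewrite /hellinger2 !sqrtrM// -mulrBr exprMn sqr_sqrtr.
Qed.

Lemma hellinger2_affinity x y : 0 <= x -> 0 <= y ->
  hellinger2 x y + 2 * Num.sqrt (x * y) = x + y.
Proof.
move=> x0 y0; rewrite /hellinger2 sqrtrM//.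
rewrite -[in RHS](sqr_sqrtr x0) -[in RHS](sqr_sqrtr y0); ring.
Qed.

Lemma sqr_sqrtD x y : 0 <= x -> 0 <= y ->
  (Num.sqrt x + Num.sqrt y) ^+ 2 = x + y + 2 * Num.sqrt (x * y).
Proof.
by move=> x0 y0; rewrite sqrtrM// sqrrD !sqr_sqrtr// addrAC mulr_natl.
Qed.

Lemma hellinger2_sqr_sqrtD x y : 0 <= x -> 0 <= y ->
  hellinger2 x y * (Num.sqrt x + Num.sqrt y) ^+ 2 = (x - y) ^+ 2.
Proof. by move=> x0 y0; rewrite -exprMn -subr_sqr !sqr_sqrtr. Qed.

(* AM-GM on [(u - v) (u + v)], where [u] and [v] are the square roots. *)
Lemma max_le_hellinger2 x y delta : 0 <= x -> 0 <= y -> 0 < delta ->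
  Num.max x y <= (1 + delta) / 2 * (x + y) + (4 * delta)^-1 * hellinger2 x y.
Proof.
move=> x0 y0 d0.
have amgm (s t : R) : s ^+ 2 <=
    (1 + delta) / 2 * (s ^+ 2 + t ^+ 2) + (4 * delta)^-1 * (s - t) ^+ 2.
  rewrite -subr_ge0.
  have -> : (1 + delta) / 2 * (s ^+ 2 + t ^+ 2) +
        (4 * delta)^-1 * (s - t) ^+ 2 - s ^+ 2 =
      (4 * delta)^-1 * (s - t - delta * (s + t)) ^+ 2 +
        delta / 4 * (s - t) ^+ 2.
    by field; rewrite gt_eqF.
  have d1 := ltW d0.
  by rewrite addr_ge0// mulr_ge0 ?sqr_ge0 ?divr_ge0// invr_ge0 mulr_ge0.
have le_x := amgm (Num.sqrt x) (Num.sqrt y).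
have le_y := amgm (Num.sqrt y) (Num.sqrt x).
rewrite -[(Num.sqrt y - _) ^+ 2]sqrrN opprB [_ + Num.sqrt x ^+ 2]addrC in le_y.
by rewrite !sqr_sqrtr// in le_x le_y; rewrite ge_max le_x.
Qed.

Section Mix.
Variables A B c x y : R.
Hypotheses (A0 : 0 <= A) (B0 : 0 <= B) (AB0 : 0 < A + B).
Hypotheses (c0 : 0 <= c) (x0 : 0 <= x) (y0 : 0 <= y).
Let X : R := A * x + B * y + c.
Let Y : R := B * x + A * y + c.

Let X0 : 0 <= X. Proof. by rewrite !addr_ge0// mulr_ge0. Qed.
Let Y0 : 0 <= Y. Proof. by rewrite !addr_ge0// mulr_ge0. Qed.

Lemma sqrt_mix_ge : (A + B) * Num.sqrt (x * y) <= Num.sqrt (X * Y).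
Proof.
rewrite -[X in X * _](ger0_norm (ltW AB0)) -sqrtr_sqr -sqrtrM ?sqr_ge0//.
rewrite ler_sqrt ?mulr_ge0// -subr_ge0.
have -> : X * Y - (A + B) ^+ 2 * (x * y) =
  A * B * (x - y) ^+ 2 + c * ((A + B) * (x + y) + c) by rewrite /X /Y; ring.
rewrite addr_ge0//; first by rewrite mulr_ge0 ?sqr_ge0// mulr_ge0.
by rewrite mulr_ge0// addr_ge0// mulr_ge0 ?(ltW AB0)// addr_ge0.
Qed.

Lemma hellinger2_mix : hellinger2 X Y <= mix_factor A B * hellinger2 x y.
Proof.
have [s_eq0|s_neq0] := eqVneq (Num.sqrt x + Num.sqrt y) 0.
  have xy_eq : x = y.
    have [] : Num.sqrt x = 0 /\ Num.sqrt y = 0.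
      by have := sqrtr_ge0 x; have := sqrtr_ge0 y; split; lra.
    by move=> /eqP + /eqP; rewrite !sqrtr_eq0 => x_le0 y_le0; move: x0 y0; lra.
  have -> : X = Y by rewrite /X /Y xy_eq; ring.
  by rewrite hellinger2xx mulr_ge0 ?hellinger2_ge0 ?divr_ge0 ?sqr_ge0 ?ltW.
have s2_gt0 : 0 < (Num.sqrt x + Num.sqrt y) ^+ 2.
  by rewrite exprn_gt0// lt_def s_neq0 addr_ge0 ?sqrtr_ge0.
rewrite /mix_factor mulrAC ler_pdivlMr// -(ler_pM2r s2_gt0).
have sum_ge : (A + B) * (Num.sqrt x + Num.sqrt y) ^+ 2 <=
    (Num.sqrt X + Num.sqrt Y) ^+ 2.
  rewrite !sqr_sqrtD//; have := sqrt_mix_ge; rewrite /X /Y.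
  move: (Num.sqrt (x * y)) (Num.sqrt _) c0 => r r'; lra.
rewrite -mulrA (le_trans (ler_wpM2l (hellinger2_ge0 X Y) sum_ge))//.
rewrite hellinger2_sqr_sqrtD// -mulrA hellinger2_sqr_sqrtD// -exprMn le_eqVlt.
by rewrite (_ : X - Y = (A - B) * (x - y)) ?eqxx//; rewrite /X /Y; ring.
Qed.

End Mix.

Lemma mix_factor_ge0 A B : 0 <= A -> 0 <= B -> 0 <= mix_factor A B.
Proof. by move=> A0 B0; rewrite divr_ge0 ?sqr_ge0 ?addr_ge0. Qed.

End SqrtDistance.

Section Hellinger.
Context {R : realType}.
Local Open Scope ereal_scope.

(* The squared Hellinger distance of [f] and [g] is the mass of this weight. *)
Definition hellinger (T : Type) (f g : T -> R) (o : T) : R :=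
  hellinger2 (f o) (g o).

Definition affinity (T : Type) (f g : T -> R) (o : T) : R :=
  Num.sqrt (f o * g o)%R.

Section MassIdentity.
Variables (T : choiceType) (f g : T -> R).

Lemma hellinger_ge0 o : (0 <= hellinger f g o)%R.
Proof. exact: hellinger2_ge0. Qed.

Lemma affinity_ge0 o : (0 <= affinity f g o)%R.
Proof. exact: sqrtr_ge0. Qed.

Hypotheses (f0 : forall o, (0 <= f o)%R) (g0 : forall o, (0 <= g o)%R).

Lemma mass_hellinger_affinity :
  mass (hellinger f g) + 2%:E * mass (affinity f g) = mass f + mass g.
Proof.
have h0 := hellinger_ge0; have a0 := affinity_ge0.
rewrite -wsum_weightZ// -!wsum_weightD// => [|o]; last by rewrite mulr_ge0.
by apply: eq_esum => o _; rewrite hellinger2_affinity.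
Qed.

Lemma mass_hellinger_le : mass (hellinger f g) <= mass f + mass g.
Proof.
rewrite -mass_hellinger_affinity leeDl// mule_ge0// wsum_ge0//;
  exact: affinity_ge0.
Qed.

Lemma le_cam_hellinger (P : pred T) (delta : R) : (0 < delta)%R ->
  wsum f (fun o => (P o)%:R%:E) + wsum g (fun o => (~~ P o)%:R%:E) <=
  ((1 + delta) / 2)%:E * (mass f + mass g) +
  ((4 * delta)^-1)%:E * mass (hellinger f g).
Proof.
move=> d0; have h0 := hellinger_ge0.
have d1 : (0 <= (1 + delta) / 2)%R by rewrite divr_ge0// addr_ge0// ltW.
have d4 : (0 <= (4 * delta)^-1)%R by rewrite invr_ge0 mulr_ge0// ltW.
have fg0 o : (0 <= (1 + delta) / 2 * (f o + g o))%R.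
  by rewrite mulr_ge0// addr_ge0.
rewrite -wsum_weightD// -!wsum_weightZ// => [|o]; last by rewrite addr_ge0.
rewrite -wsum_weightD// => [|o]; last by rewrite mulr_ge0.
rewrite /wsum -esumD => [|o _|o _]; [|by rewrite mule_ge0 ?lee_fin..].
apply: le_esum => o _; rewrite mule1 -!EFinM -EFinD lee_fin.
apply: le_trans (max_le_hellinger2 (f0 o) (g0 o) d0).
by rewrite le_max; case: (P o) => /=;
  rewrite !(mulr0, mulr1, addr0, add0r) lexx ?orbT.
Qed.

End MassIdentity.

Section PoissonHellinger.
Variables (T : choiceType) (f g : T -> R) (m : R).
Hypotheses (f0 : forall o, (0 <= f o)%R) (g0 : forall o, (0 <= g o)%R).
Hypotheses (fm : mass f = m%:E) (gm : mass g = m%:E).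

Lemma affinity_poisson :
  affinity (poisson_weight f) (poisson_weight g) =
  poisson_weight (affinity f g).
Proof.
apply/funext => l; rewrite /affinity /poisson_weight.
have n0 : (0 <= (size l)`!%:R^-1 :> R)%R by rewrite invr_ge0.
rewrite mulrACA -expr2 sqrtrM ?sqr_ge0// sqrtr_sqr ger0_norm//; congr (_ * _)%R.
rewrite -big_split/=; elim: l {n0} => [|o l IHl];
  first by rewrite !big_nil sqrtr1.
by rewrite !big_cons -IHl sqrtrM ?mulr_ge0.
Qed.

Lemma hellinger_fin_num : mass (hellinger f g) \is a fin_num.
Proof.
rewrite ge0_fin_numE ?wsum_ge0//; last exact: hellinger_ge0.
by apply: le_lt_trans (mass_hellinger_le f0 g0) _; rewrite fm gm -EFinD ltry.
Qed.

Lemma mass_affinity h : mass (hellinger f g) = h%:E ->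
  mass (affinity f g) = (m - h / 2)%:E.
Proof.
have := mass_hellinger_affinity f0 g0; rewrite fm gm => + hE; rewrite hE.
move=> /EFin_addl_eq; case: (wsum (affinity f g) _) => [c [c_eq]| |];
  last 2 first.
- by rewrite gt0_muley ?lte_fin.
- by rewrite gt0_muleNy ?lte_fin.
by congr EFin; move: c_eq; lra.
Qed.

(* [1 - exp (- h / 2) <= h / 2], where [h] is the squared distance of [f] and
   [g]. *)
Lemma mass_hellinger_poisson_le :
  mass (hellinger (poisson_weight f) (poisson_weight g)) <=
  (expR m)%:E * mass (hellinger f g).
Proof.
have /esym := fineK hellinger_fin_num; move: (fine _) => h hE.
have := mass_hellinger_affinity (poisson_weight_ge0 f0) (poisson_weight_ge0 g0).
rewrite affinity_poisson (mass_poisson_weight _ (mass_affinity hE));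
  last exact: affinity_ge0.
rewrite (mass_poisson_weight f0 fm) (mass_poisson_weight g0 gm) addeC -EFinM.
move=> /EFin_addl_eq ->.
rewrite hE -EFinM lee_fin [expR (m - _)]expRD -subr_ge0.
rewrite (_ : _ - _ = 2 * (expR m * (expR (- (h / 2)) - (1 - h / 2))))%R;
  last by field.
by rewrite !mulr_ge0 ?expR_ge0// subr_ge0 expR_ge1Dx.
Qed.

(* The one-point configurations contribute exactly the squared distance of [f]
   and [g]. *)
Lemma wsum_hellinger_poisson_ne1_le :
  wsum (hellinger (poisson_weight f) (poisson_weight g))
    (fun l => if size l == 1%N then 0 else 1) <=
  (expR m - 1)%:E * mass (hellinger f g).
Proof.
have hell0 := hellinger_ge0 (poisson_weight f) (poisson_weight g).
have single : wsum (hellinger (poisson_weight f) (poisson_weight g))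
    (fun l => if size l == 1%N then 1 else 0) = mass (hellinger f g).
  rewrite wsum_singletons//; apply: eq_esum => o _.
  by rewrite /hellinger !poisson_weight_single.
have := mass_hellinger_poisson_le.
rewrite (wsumID hell0 (fun l => size l == 1%N))// single.
rewrite -leeBrDl ?hellinger_fin_num//.
have /esym := fineK hellinger_fin_num; move: (fine _) => h ->.
by rewrite -!EFinM -EFinB mulrBl mul1r.
Qed.

End PoissonHellinger.
End Hellinger.

(** * Contraction and impossibility of recovery *)

Section Contraction.
Context {R : realType}.
Variables p q : R.
Hypotheses (p0 : 0 < p) (q0 : 0 < q).
Local Notation T := (tree (option bool)).
Local Notation childless_prob := (childless_prob p q).
Local Notation no_dead_prob := (no_dead_prob p q).
Local Notation grandchild_mass := (grandchild_mass p q).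

Definition path_factor : R :=
  mix_factor (p ^+ 2 + no_dead_prob * q ^+ 2) (2 * (p * q)).

(* [path_factor] replaces the factor of two consecutive edges below a vertex
   with a single observed child, where the cuts act. *)
Definition block_factor : R :=
  mix_factor p q ^+ 2 * (1 - expR (- grandchild_mass)) +
  expR (- grandchild_mass) * path_factor.

Let p_ge0 : 0 <= p := ltW p0.
Let q_ge0 : 0 <= q := ltW q0.
Let pq_gt0 : 0 < p + q. Proof. exact: addr_gt0. Qed.
Let edge_ge0 : 0 <= mix_factor p q. Proof. exact: mix_factor_ge0. Qed.
Let exp_ge0 : 0 <= expR (- grandchild_mass). Proof. exact: expR_ge0. Qed.
Let exp_le1 : 0 <= 1 - expR (- grandchild_mass).
Proof.
by rewrite subr_ge0 -[leRHS]expR0 ler_expR oppr_le0 grandchild_mass_ge0.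
Qed.
Let same_ge0 : 0 <= p ^+ 2 + no_dead_prob * q ^+ 2.
Proof. by rewrite addr_ge0 ?mulr_ge0 ?sqr_ge0 ?no_dead_prob_ge0. Qed.
Let opp_gt0 : 0 < 2 * (p * q). Proof. by rewrite !mulr_gt0. Qed.

Lemma path_factor_ge0 : 0 <= path_factor.
Proof. by rewrite mix_factor_ge0// ltW. Qed.

Lemma block_factor_ge0 : 0 <= block_factor.
Proof.
by rewrite addr_ge0// mulr_ge0 ?path_factor_ge0 ?sqr_ge0.
Qed.

Local Open Scope ereal_scope.

Section Step.
Variable L : bool -> T -> R.
Hypothesis L0 : forall s o, (0 <= L s o)%R.
Hypothesis L_mass : forall s, mass (L s) = (live_mass p q)%:E.
Local Notation grandchild := (grandchild_weight p q L).
Local Notation forest := (forest_weight p q L).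

Lemma mass_hellinger_grandchild_le :
  mass (hellinger (grandchild true) (grandchild false)) <=
  (mix_factor p q)%:E * mass (hellinger (L true) (L false)).
Proof.
rewrite -wsum_weightZ//; last exact: hellinger_ge0.
apply: le_wsum_weight => // o.
rewrite /hellinger /grandchild_weight /own_weight /opp_weight /=.
set c := (childless_prob * (o == Node None [::])%:R)%R.
have c0 : (0 <= p * c)%R by rewrite !mulr_ge0 ?childless_prob_ge0.
have := hellinger2_mix p_ge0 q_ge0 pq_gt0 c0 (L0 true o) (L0 false o).
by congr (hellinger2 _ _ <= _)%R; ring.
Qed.

Lemma forest_weight_ne1 s l : size l != 1%N ->
  forest s l = (expR (- grandchild_mass) *
    (p * poisson_weight (grandchild s) l +
     q * poisson_weight (grandchild (~~ s)) l))%R.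
Proof.
by case: l => [|o [|o' l]] //= _; rewrite /forest_weight /kept_weight; ring.
Qed.

Lemma forest_weight_single s o :
  forest s [:: o] = (expR (- grandchild_mass) *
    ((p ^+ 2 + no_dead_prob * q ^+ 2) * L s o + 2 * (p * q) * L (~~ s) o +
     p * (p + q) * (childless_prob * (o == Node None [::])%:R)))%R.
Proof.
by rewrite /forest_weight /kept_weight /own_weight /opp_weight negbK; ring.
Qed.

Lemma hellinger_forest_ne1_le l : size l != 1%N ->
  (hellinger (forest true) (forest false) l <=
   expR (- grandchild_mass) * mix_factor p q *
   hellinger (poisson_weight (grandchild true))
     (poisson_weight (grandchild false)) l)%R.
Proof.
move=> l1; rewrite /hellinger !forest_weight_ne1//= hellinger2M//.
rewrite -[leRHS]mulrA ler_wpM2l//.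
have P0 s := poisson_weight_ge0 (grandchild_weight_ge0 p0 q0 L0 s) l.
have := hellinger2_mix p_ge0 q_ge0 pq_gt0 (lexx 0%R) (P0 true) (P0 false).
by rewrite !addr0 [(q * _ + p * _)%R]addrC.
Qed.

Lemma hellinger_forest_single_le o :
  (hellinger (forest true) (forest false) [:: o] <=
   expR (- grandchild_mass) * path_factor * hellinger (L true) (L false) o)%R.
Proof.
rewrite /hellinger !forest_weight_single/= hellinger2M//.
rewrite -[leRHS]mulrA ler_wpM2l//.
rewrite [(_ * L false o + _ * L true o)%R]addrC.
apply: hellinger2_mix => //; first exact: ltW.
  exact: ltr_wpDl.
by rewrite !mulr_ge0 ?childless_prob_ge0 ?addr_ge0.
Qed.

Lemma mass_hellinger_forest_le :
  mass (hellinger (forest true) (forest false)) <=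
  block_factor%:E * mass (hellinger (L true) (L false)).
Proof.
have hell_forest0 := hellinger_ge0 (forest true) (forest false).
have hell_L0 := hellinger_ge0 (L true) (L false).
set h := mass (hellinger (L true) (L false)).
have grandchild0 := grandchild_weight_ge0 p0 q0 L0.
have grandchildm := grandchild_weight_mass p0 q0 L0 L_mass.
rewrite [leLHS](wsumID hell_forest0 (fun l => size l == 1%N))//.
rewrite wsum_singletons//.
have path0 := mulr_ge0 exp_ge0 path_factor_ge0.
have edge0 := mulr_ge0 exp_ge0 edge_ge0.
have edges0 := mulr_ge0 (sqr_ge0 (mix_factor p q)) exp_le1.
rewrite /block_factor EFinD ge0_muleDl ?lee_fin//.
rewrite [leLHS]addeC leeD//; last first.
  rewrite -wsum_weightZ//.
  by apply: le_wsum_weight => // o; exact: hellinger_forest_single_le.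
pose hell_poisson := hellinger (poisson_weight (grandchild true))
  (poisson_weight (grandchild false)).
apply: (@le_trans _ _ ((expR (- grandchild_mass) * mix_factor p q)%:E *
    wsum hell_poisson (fun l => if size l == 1%N then 0 else 1))).
  rewrite -wsum_weightZ//; last 2 first.
  - exact: hellinger_ge0.
  - by move=> l; case: ifP.
  apply: le_esum => l _; case: ifPn => l_ne1; first by rewrite !mule0.
  by rewrite !mule1 lee_fin hellinger_forest_ne1_le.
apply: (@le_trans _ _ ((expR (- grandchild_mass) * mix_factor p q)%:E *
    ((expR grandchild_mass - 1)%:E * ((mix_factor p q)%:E * h)))).
  rewrite lee_wpmul2l ?lee_fin//.
  apply: le_trans (wsum_hellinger_poisson_ne1_le (grandchild0 true)
    (grandchild0 false) (grandchildm true) (grandchildm false)) _.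
  rewrite lee_wpmul2l ?mass_hellinger_grandchild_le// lee_fin subr_ge0.
  by rewrite -expR0 ler_expR grandchild_mass_ge0.
rewrite !muleA -!EFinM le_eqVlt; apply/orP; left; apply/eqP; congr (_%:E * _).
rewrite expRN; field; exact: lt0r_neq0 (expR_gt0 _).
Qed.

Lemma mass_hellinger_next_le :
  mass (hellinger (next_law p q L true) (next_law p q L false)) <=
  block_factor%:E * mass (hellinger (L true) (L false)).
Proof.
pose child := child_weight p q L; pose m := child_mass p q.
have child0 := child_weight_ge0 p0 q0 L0.
have childm := child_weight_mass p0 q0 L0 L_mass.
have node_weight_hellinger phi psi :
    mass (hellinger (node_weight phi) (node_weight psi)) =
    mass (hellinger phi psi) :> \bar R.
  rewrite -[RHS](@wsum_node_weight _ _ (fun=> 1))//; last exact: hellinger_ge0.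
  by apply: eq_esum => -[[y|] l] _ //=; rewrite /hellinger /= hellinger2xx.
rewrite (le_trans _ mass_hellinger_forest_le)// node_weight_hellinger.
apply: (@le_trans _ _ ((expR (- m))%:E *
    mass (hellinger (poisson_weight (child true))
      (poisson_weight (child false))))).
  rewrite -wsum_weightZ ?expR_ge0//; last exact: hellinger_ge0.
  apply: le_wsum_weight => // l; rewrite /hellinger; case: ifP => _; last first.
    by rewrite hellinger2M ?expR_ge0.
  by rewrite hellinger2xx mulr_ge0 ?expR_ge0 ?hellinger2_ge0.
apply: (@le_trans _ _ ((expR (- m))%:E *
    ((expR m)%:E * mass (hellinger (child true) (child false))))).
  rewrite lee_wpmul2l ?lee_fin ?expR_ge0//.
  exact: mass_hellinger_poisson_le.
by rewrite muleA -EFinM -expRD addNr expR0 mul1e node_weight_hellinger.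
Qed.

End Step.
End Contraction.

Section Recovery.
Context {R : realType}.
Variables p q : R.
Hypotheses (p0 : 0 < p) (q0 : 0 < q).
Local Notation T := (tree (option bool)).
Local Notation empty := (Node None [::] : T).
Local Notation pmf := (broadcast_pmf (2 * p) (2 * q)).
Local Notation childless_prob := (childless_prob p q).
Local Open Scope ereal_scope.

Lemma broadcast_pmf_childless d s : pmf d.+1 s (Node s [::]) = childless_prob.
Proof. by rewrite broadcast_pmfS// eqxx !poisson_weight_nil !mulr1. Qed.

Lemma wsum_broadcast_childless d s (c : \bar R) : 0 <= c ->
  wsum (pmf d.+1 s) (fun t => if childless t then c else 0) =
  childless_prob%:E * c.
Proof.
move=> c0; rewrite -(broadcast_pmf_childless d s).
rewrite -wsum_pred1 ?broadcast_pmf_ge0//.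
apply: eq_wsum => -[x [|t cs]] /broadcast_pmf_neq0/eqP /= ->; last by case: eqP.
by rewrite eqxx.
Qed.

Lemma live_law_exists d : exists2 L : bool -> T -> R,
  forall s o, (0 <= L s o)%R & live_law p q d.+1 L.
Proof.
pose live t := if childless t then None else Some (observation d.+1 t).
have pmf0 s t := broadcast_pmf_ge0 (2 * p)%R (2 * q)%R d.+1 s t.
have law s := wsum_pushforward (pmf0 s) live (mass_broadcast p0 q0 d.+1 s).
have [[Lt Lt0 LtE] [Lf Lf0 LfE]] := (law true, law false).
exists (fun s => if s then Lt else Lf) => [s o|s F F0 F_inv]; first by case: s.
have -> : wsum (if s then Lt else Lf) (F true) =
    wsum (pmf d.+1 s) (fun t => if live t is Some o then F true o else 0).
  by case: s; rewrite ?LtE ?LfE.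
rewrite (wsumID (pmf0 s) (@childless bool))// addeC; congr (_ + _).
  by apply: eq_wsum => t _; rewrite /live; case: (childless t).
rewrite -(wsum_broadcast_childless d s)//.
apply: eq_wsum => t /broadcast_pmf_neq0/eqP ts.
case: ifP => // t_childless; rewrite /observation adversary_childless//.
by case: t {ts} t_childless => x [].
Qed.

Lemma live_law_contracting n : exists L : bool -> T -> R,
  [/\ forall s o, (0 <= L s o)%R, live_law p q n.*2.+1 L &
      mass (hellinger (L true) (L false)) <= (2 * block_factor p q ^+ n)%:E].
Proof.
elim: n => [|n [L [L0 L_law LH]]].
  have [L L0 L_law] := live_law_exists 0; exists L; split => //.
  apply: le_trans (mass_hellinger_le (L0 true) (L0 false)) _.
  rewrite !(live_law_mass p0 q0 L_law) -EFinD lee_fin expr0 /live_mass.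
  have := childless_prob_ge0 p q; lra.
exists (next_law p q L); split.
- exact: next_law_ge0 L_law.
- exact: live_law_next.
apply: le_trans (mass_hellinger_next_le p0 q0 L0 (live_law_mass p0 q0 L_law)) _.
by rewrite exprS mulrCA [leRHS]EFinM lee_wpmul2l// lee_fin block_factor_ge0.
Qed.

Lemma broadcast_pmfD (a b : R) d t :
  (broadcast_pmf a b d true t + broadcast_pmf a b d false t)%R =
  broadcast_pmf a b d (root_label t) t.
Proof.
have root s : s != root_label t -> broadcast_pmf a b d s t = 0%R.
  by apply: contraNeq => /broadcast_pmf_neq0; rewrite eq_sym.
case ts : (root_label t); first by rewrite (root false) ?ts ?addr0.
by rewrite (root true) ?ts ?add0r.
Qed.

Lemma broadcast_probE (a b : R) d A : broadcast_prob a b d A = (2^-1)%:E *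
  (wsum (broadcast_pmf a b d true) (fun t => (t \in A)%:R%:E) +
   wsum (broadcast_pmf a b d false) (fun t => (t \in A)%:R%:E)).
Proof.
have pmf0 s t := broadcast_pmf_ge0 a b d s t.
rewrite -wsum_weightD// -wsum_weightZ// => [|t]; last by rewrite addr_ge0.
rewrite /broadcast_prob esum_mkcond; apply: eq_esum => t _.
by rewrite broadcast_pmfD; case: ifP => _; rewrite ?mule1 ?mule0.
Qed.

Section RecoveryBound.
Variables (d : nat) (L : bool -> T -> R) (est : nat -> T -> bool).
Hypothesis L0 : forall s o, (0 <= L s o)%R.
Hypothesis L_law : live_law p q d.+1 L.
Hypothesis est_inv : root_estimator est.

Let recovery_prob := broadcast_prob (2 * p) (2 * q) d.+1
  [set t | est d.+1 (observation d.+1 t) = root_label t].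

(* A childless root is observed without any information on its spin. *)
Lemma recovery_probE : recovery_prob = (2^-1)%:E *
  (wsum (L true) (fun o => (est d.+1 o)%:R%:E) +
   wsum (L false) (fun o => (~~ est d.+1 o)%:R%:E) + childless_prob%:E).
Proof.
pose guess s o : \bar R := (est d.+1 o == s)%:R%:E.
have guess_law s : wsum (pmf d.+1 s) (fun t =>
      (t \in [set t | est d.+1 (observation d.+1 t) = root_label t])%:R%:E) =
    wsum (L s) (guess s) + childless_prob%:E * guess s empty.
  rewrite -(L_law s (F := fun=> guess s)).
  - apply: eq_wsum => t /broadcast_pmf_neq0/eqP ts; congr (nat_of_bool _)%:R%:E.
    by apply/idP/eqP; rewrite inE /= ts.
  - by move=> c o; rewrite lee_fin.
  - by move=> c o o' oo'; rewrite /guess (est_inv _ oo').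
rewrite /recovery_prob broadcast_probE !guess_law addeACA.
rewrite -ge0_muleDr ?lee_fin//.
congr (_ * (_ + _ + _)).
- by apply: eq_wsum => o _; rewrite /guess eqb_id.
- by apply: eq_wsum => o _; rewrite /guess eqbF_neg.
- by rewrite /guess; case: est; rewrite ?adde0 ?add0e mule1.
Qed.

Lemma recovery_prob_le (delta h : R) :
  (0 < delta)%R -> mass (hellinger (L true) (L false)) <= h%:E ->
  recovery_prob <= (2^-1 + (delta / 2 + (8 * delta)^-1 * h))%:E.
Proof.
move=> d0 Lh; have := le_cam_hellinger (L0 true) (L0 false) (est d.+1) d0.
rewrite !(live_law_mass p0 q0 L_law) -EFinD => test_le.
have i0 : (0 <= (4 * delta)^-1)%R by rewrite invr_ge0 mulr_ge0// ltW.
have le_h : ((4 * delta)^-1)%:E * mass (hellinger (L true) (L false)) <=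
    ((4 * delta)^-1 * h)%:E by rewrite EFinM lee_wpmul2l.
rewrite recovery_probE;
  apply: le_trans (lee_wpmul2l _ (leeD2r _ test_le)) _ => //.
rewrite -EFinM.
apply: le_trans (lee_wpmul2l _ (leeD2r _ (leeD2l _ le_h))) _ => //.
rewrite -!EFinD -EFinM lee_fin.
rewrite (_ : (8 * delta)^-1 = (4 * delta)^-1 / 2)%R; last first.
  by field; rewrite gt_eqF.
have : (0 <= delta * childless_prob)%R.
  by rewrite mulr_ge0 ?childless_prob_ge0// ltW.
by rewrite /live_mass; move: (4 * delta)^-1%R => i; lra.
Qed.

End RecoveryBound.

Lemma no_partial_recovery est :
  (block_factor p q < 1)%R -> root_estimator est ->
  ~ partial_recovery (2 * p) (2 * q) adversary est.
Proof.
move=> lt1 est_inv [eta eta2 [N _ recover]].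
have bf0 := block_factor_ge0 p0 q0.
pose delta := (eta - 2^-1)%R; have d0 : (0 < delta)%R by rewrite subr_gt0.
have : (fun n => block_factor p q ^+ n)%R @ \oo --> (0 : R)%R.
  by apply: cvg_expr; rewrite ger0_norm.
move=> /cvgrPdist_lt /(_ (2 * delta ^+ 2)%R)[|M _ small].
  by rewrite mulr_gt0 ?exprn_gt0.
have := small (maxn N M) (leq_maxr N M); set n := maxn N M.
rewrite sub0r normrN ger0_norm ?exprn_ge0// => bfn_lt.
have [L [L0 L_law LH]] := live_law_contracting n.
have le_Nn : (N <= n.*2.+1)%N.
  by rewrite -addnn ltnW// ltnS (leq_trans (leq_maxl N M))// leq_addr.
have := le_trans (recover _ le_Nn) (recovery_prob_le L0 L_law est_inv d0 LH).
apply/negP; rewrite -ltNge lte_fin -ltrBrDl -/delta.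
rewrite -ltrBrDl (_ : delta - delta / 2 = delta / 2)%R; last by field.
rewrite mulrC ltr_pdivrMr ?mulr_gt0//; move: bfn_lt.
by move: (_ ^+ n)%R => z; lra.
Qed.

End Recovery.

(** * Choice of the parameters *)

Section CriticalRates.
Context {R : realType}.
Variables p q : R.
Hypotheses (q0 : 0 < q) (qp : q < p) (pq1 : 1 < p + q).
Hypothesis critical : (p - q) ^+ 2 = p + q.

Let p0 : 0 < p := lt_trans q0 qp.
Let pq0 : 0 < p + q := addr_gt0 p0 q0.

Lemma cube_childless_prob_lt1 : q ^+ 3 * childless_prob p q < 1.
Proof.
rewrite /childless_prob expRN ltr_pdivrMr ?expR_gt0// mul1r.
apply: lt_le_trans (_ : expR (2 * q) <= _); last first.
  by rewrite ler_expR; move: qp; lra.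
apply: lt_le_trans (expR_ge1Dxn 2 _); last by rewrite mulr_ge0// ltW.
have : 0 < q ^+ 3 by rewrite exprn_gt0.
by rewrite (_ : 3`! = 6)%N// exprMn; move: (q ^+ 3) => z; lra.
Qed.

Lemma cut_weight_bounds : 0 < q ^+ 2 * (1 - no_dead_prob p q) < 1.
Proof.
have r0 : 0 < dead_rate p q by rewrite mulr_gt0// expR_gt0.
rewrite mulr_gt0 ?exprn_gt0//=; last by rewrite subr_gt0 expR_lt1 oppr_lt0.
apply: le_lt_trans cube_childless_prob_lt1.
rewrite [q ^+ 3]exprSr -mulrA ler_wpM2l ?sqr_ge0//.
by have := expR_ge1Dx (- dead_rate p q); rewrite /no_dead_prob /dead_rate; lra.
Qed.

(* With [x] the weight lost by cutting and [k = p + q], this is the inequality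
   [(k - x) ^ 2 < k ^ 2 - x], that is [0 < x < 2 k - 1]. *)
Lemma path_factor_lt1 : path_factor p q < 1.
Proof.
have /andP[x0 x1] := cut_weight_bounds; set x := q ^+ 2 * _ in x0 x1.
rewrite /path_factor /mix_factor.
rewrite (_ : _ - 2 * (p * q) = p + q - x); last by rewrite -critical /x; ring.
rewrite (_ : _ + 2 * (p * q) = (p + q) ^+ 2 - x); last by rewrite /x; ring.
have k2 : 0 < (p + q) ^+ 2 - x.
  rewrite subr_gt0 (lt_trans x1)// expr_gt1// ltW//.
rewrite ltr_pdivrMr// mul1r -subr_gt0.
rewrite (_ : _ - _ = x * (2 * (p + q) - 1 - x)); last by ring.
by rewrite mulr_gt0//; move: x1 pq1; lra.
Qed.

Lemma block_factor_lt1 : block_factor p q < 1.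
Proof.
have edge1 : mix_factor p q = 1 by rewrite /mix_factor critical divff// gt_eqF.
rewrite /block_factor edge1 expr1n mul1r -ltrBrDl opprB addrC subrK.
by rewrite gtr_pMr ?expR_gt0// path_factor_lt1.
Qed.

End CriticalRates.

Section Continuity.
Context {R : realType} {T : Type} {F : set_system T} {FF : Filter F}.
Implicit Types (f g : T -> R) (A B p q : R).

Lemma cvg_expR f A : f @ F --> A -> expR (f x) @[x --> F] --> expR A.
Proof. by move=> fA; apply: continuous_cvg fA; exact: continuous_expR. Qed.

Lemma cvg_exprn n f A : f @ F --> A -> f x ^+ n @[x --> F] --> A ^+ n.
Proof. by move=> fA; exact: cvg_comp fA (@exprn_continuous R n A). Qed.

Lemma cvg_mix_factor f g A B : A + B != 0 -> f @ F --> A -> g @ F --> B ->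
  mix_factor (f x) (g x) @[x --> F] --> mix_factor A B.
Proof.
move=> AB0 fA gB; apply: cvgM; first by apply: cvg_exprn; exact: cvgB.
by apply: cvgV => //; exact: cvgD.
Qed.

Lemma cvg_block_factor f g p q : 0 < p -> 0 < q -> f @ F --> p -> g @ F --> q ->
  block_factor (f x) (g x) @[x --> F] --> block_factor p q.
Proof.
move=> p0 q0 fp gq.
have childless_cvg :
    childless_prob (f x) (g x) @[x --> F] --> childless_prob p q.
  by apply: cvg_expR; apply: cvgN; exact: cvgD.
have no_dead_cvg : no_dead_prob (f x) (g x) @[x --> F] --> no_dead_prob p q.
  by apply: cvg_expR; apply: cvgN; exact: cvgM.
have mass_cvg : grandchild_mass (f x) (g x) @[x --> F] --> grandchild_mass p q.
  by apply: cvgD => //; apply: cvgM => //; apply: cvgB => //; exact: cvg_cst.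
have exp_cvg : expR (- grandchild_mass (f x) (g x)) @[x --> F] -->
    expR (- grandchild_mass p q) by apply: cvg_expR; exact: cvgN.
have edge_cvg : mix_factor (f x) (g x) @[x --> F] --> mix_factor p q.
  by apply: cvg_mix_factor => //; rewrite gt_eqF ?addr_gt0.
have path_cvg : path_factor (f x) (g x) @[x --> F] --> path_factor p q.
  apply: cvg_mix_factor; last 2 first.
  - by apply: cvgD; [exact: cvg_exprn|apply: cvgM => //; exact: cvg_exprn].
  - by apply: cvgM; [exact: cvg_cst|exact: cvgM].
  by rewrite gt_eqF ?addr_gt0 ?mulr_gt0 ?exprn_gt0 ?expR_gt0.
apply: cvgD; last exact: cvgM.
by apply: cvgM; [exact: cvg_exprn|apply: cvgB => //; exact: cvg_cst].
Qed.

End Continuity.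

Section SubcriticalChoice.
Context {R : realType}.
Variable k : R.
Hypothesis k1 : 1 < k.

Let k0 : 0 < k := lt_trans ltr01 k1.

Definition critical_eps : R := (1 - Num.sqrt k^-1) / 2.

Lemma critical_eps_gt0 : 0 < critical_eps.
Proof.
by rewrite divr_gt0// subr_gt0 -[ltRHS]sqrtr1 ltr_sqrt// invf_lt1.
Qed.

Lemma critical_eps_lt : critical_eps < 2^-1.
Proof. by rewrite ltr_pdivrMr// mulVf// ltrBlDr ltrDl sqrtr_gt0 invr_gt0. Qed.

Lemma critical_epsE : k * (1 - 2 * critical_eps) ^+ 2 = 1.
Proof.
rewrite /critical_eps (_ : 1 - _ = Num.sqrt k^-1); last by field.
by rewrite sqr_sqrtr ?invr_ge0 ?(ltW k0)// divff// gt_eqF.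
Qed.

Lemma block_factor_critical_lt1 :
  block_factor (k * (1 - critical_eps)) (k * critical_eps) < 1.
Proof.
have e0 := critical_eps_gt0; have e2 := critical_eps_lt.
have eE := critical_epsE.
move: critical_eps e0 e2 eE => e e0 e2 eE.
apply: block_factor_lt1.
- exact: mulr_gt0.
- by rewrite ltr_pM2l//; move: e2; lra.
- by rewrite -mulrDr subrK mulr1.
- rewrite -mulrBr (_ : 1 - e - e = 1 - 2 * e); last by ring.
  by rewrite exprMn expr2 -mulrA eE -mulrDr subrK.
Qed.

Lemma contracting_eps_exists : exists eps : R,
  [/\ 0 < eps, eps < 2^-1, 1 < k * (1 - 2 * eps) ^+ 2 &
      block_factor (k * (1 - eps)) (k * eps) < 1].
Proof.
have e0 := critical_eps_gt0; have e2 := critical_eps_lt.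
have near_lt1 : \forall e \near critical_eps^'-,
    block_factor (k * (1 - e)) (k * e) < 1.
  apply: cvgr_lt block_factor_critical_lt1; apply: cvg_at_left_filter.
  apply: cvg_block_factor; last 2 first.
  - apply: cvgM; first exact: cvg_cst.
    by apply: cvgB; [exact: cvg_cst|exact: cvg_id].
  - by apply: cvgM; [exact: cvg_cst|exact: cvg_id].
  - by rewrite mulr_gt0//; move: e2; lra.
  - exact: mulr_gt0.
have [e [[e_gt0 e_lt] e_lt1]] := filter_ex (filterI
  (filterI (nbhs_left_gt e0) (nbhs_left_lt critical_eps)) near_lt1).
exists e; split => //; first exact: lt_trans e_lt e2.
by rewrite -[ltLHS]critical_epsE ltr_pM2l// ltr_sqr ?nnegrE; move: e_lt e2; lra.
Qed.

End SubcriticalChoice.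

Theorem theorem3 (R : realType) (k : R) (hk : 1 < k) :
  exists eps : R,
    [/\ 0 < eps, eps < 2^-1, 1 < k * (1 - 2 * eps) ^+ 2 &
      exists2 adv : nat -> tree bool -> tree bool,
        cutting_adversary adv &
        forall est : nat -> tree (option bool) -> bool,
          root_estimator est ->
          ~ partial_recovery (2 * k * (1 - eps)) (2 * k * eps) adv est].
Proof.
have k0 : 0 < k := lt_trans ltr01 hk.
have [eps [eps0 eps2 supercritical contracting]] := contracting_eps_exists hk.
exists eps; split => //; exists adversary; first exact: adversary_cutting.
move=> est est_inv; rewrite -!mulrA; apply: no_partial_recovery => //.
- by rewrite mulr_gt0//; move: eps2; lra.
- exact: mulr_gt0.
Qed.
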